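(* Let $m\ge 1$ and let $\psi$ be a wavelet on $\mathbb{R}^n$ for which there are constants $A,\varepsilon,\varepsilon'>0$ such that $|\psi(x)|\le A(1+|x|)^{-n-\varepsilon}$ for all $x\in\mathbb{R}^n$ and $\int_{\mathbb{R}^n}|\psi(x-y)-\psi(x)|\,dx\le A|y|^{\varepsilon'}$ for all $y\neq 0$. Then $S^m_{\mathrm{cont},2}$ maps $L^2(\mathbb{R}^n)$ into $L^2(\mathbb{R}_+^m)$ and $S^m_{\mathrm{dyad},2}$ maps $L^2(\mathbb{R}^n)$ into $\ell^2(\mathbb{Z}^m)$; that is, $\|S^m_{\mathrm{cont},2}f\|_{L^2(\mathbb{R}_+^m)}<\infty$ and $\|S^m_{\mathrm{dyad},2}f\|_{\ell^2(\mathbb{Z}^m)}<\infty$ for every $f\in L^2(\mathbb{R}^n)$.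
   Context: $\mathbb{R}_+=(0,\infty)$. A wavelet is a function $\psi:\mathbb{R}^n\to\mathbb{C}$ in $L^1(\mathbb{R}^n)\cap L^2(\mathbb{R}^n)$ with $\int\psi=0$. For $\lambda\in\mathbb{R}_+$, $\psi_\lambda(x)=\lambda^{-n/2}\psi(\lambda^{-1}x)$; for $j\in\mathbb{Z}$, $\psi_j(x)=2^{-nj}\psi(2^{-j}x)$. The $m$-layer scattering transforms are $$S^m_{\mathrm{cont},2}f(\lambda_1,\dots,\lambda_m)=\big\|\,|\cdots||f*\psi_{\lambda_1}|*\psi_{\lambda_2}|*\cdots|*\psi_{\lambda_m}\big\|_{L^2(\mathbb{R}^n)},\qquad S^m_{\mathrm{dyad},2}f(j_1,\dots,j_m)=\big\|\,|\cdots||f*\psi_{j_1}|*\psi_{j_2}|*\cdots|*\psi_{j_m}\big\|_{L^2(\mathbb{R}^n)}$$ (a modulus is taken after each of the first $m-1$ convolutions). The norms are the weighted norm $$\|F\|_{L^2(\mathbb{R}_+^m)}^2=\int_0^\infty\cdots\int_0^\infty|F(\lambda_1,\dots,\lambda_m)|^2\frac{d\lambda_1}{\lambda_1^{n+1}}\cdots\frac{d\lambda_m}{\lambda_m^{n+1}}$$ and $\|F\|_{\ell^2(\mathbb{Z}^m)}^2=\sum_{j_1,\dots,j_m\in\mathbb{Z}}|F(j_1,\dots,j_m)|^2$. *)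

(* Defs.v *)
From HB Require Import structures.
From mathcomp Require Import all_boot all_order all_algebra.
From mathcomp Require Import complex.
From mathcomp Require Import all_classical all_reals all_analysis measurable_realfun.

Set Implicit Arguments.
Unset Strict Implicit.
Unset Printing Implicit Defensive.

Import Order.TTheory GRing.Theory Num.Theory.
Import numFieldNormedType.Exports.
Import ComplexField Normc.

Local Open Scope classical_set_scope.
Local Open Scope ring_scope.
Local Open Scope complex_scope.

(* The sigma-algebra on 'rV[T]_n is generated by the coordinate maps, as in the
   library's instance for n.-tuple T; for T = R it is the Borel one. *)
Definition measure_rV_display : measure_display -> measure_display.
Proof. exact. Qed.

Section measurable_rV.
Context {d} {T : sigmaRingType d}.
Variable n : nat.

Let coors : 'I_n -> 'rV[T]_n -> T := fun i x => x ord0 i.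

Let rV_set0 : g_sigma_preimage coors set0.
Proof. exact: sigma_algebra0. Qed.

Let rV_setC A : g_sigma_preimage coors A -> g_sigma_preimage coors (~` A).
Proof. exact: sigma_algebraC. Qed.

Let rV_bigcup (F : _^nat) : (forall i, g_sigma_preimage coors (F i)) ->
  g_sigma_preimage coors (\bigcup_i (F i)).
Proof. exact: sigma_algebra_bigcup. Qed.

HB.instance Definition _ := @isMeasurable.Build (measure_rV_display d)
  'rV[T]_n (g_sigma_preimage coors) rV_set0 rV_setC rV_bigcup.

End measurable_rV.

Section measurable_rV_theory.
Context {d1 d2} {T1 : measurableType d1} {T2 : measurableType d2}.

Lemma measurable_fun_rVP n (f : T1 -> 'rV[T2]_n) :
  measurable_fun [set: T1] f <->
  forall i, measurable_fun [set: T1] (fun x => f x ord0 i).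
Proof.
apply: (@iff_trans _ (g_sigma_preimage
    (fun i => (fun x : 'rV[T2]_n => x ord0 i) \o f) `<=` measurable)).
  rewrite g_sigma_preimage_comp; split=> [mf A [/= C preC <-]|prefS].
    exact: mf.
  by move=> _ A mA; apply: prefS; exists A.
split=> [fS i _ A mA|mf].
  apply: fS; apply: sub_sigma_algebra.
  case: n i => [[] []//|n i] in f *.
  rewrite -bigcup_mkord_ord; exists i; first exact: ltn_ord.
  by exists A => //; rewrite inord_val.
apply: smallest_sub; first exact: sigma_algebra_measurable.
case: n => [|n] in f mf *; first by rewrite big_ord0.
rewrite -bigcup_mkord_ord; apply: bigcup_sub => i Ii A [B mB <-].
exact: mf.
Qed.

Lemma measurable_rV_coord n (i : 'I_n) :
  measurable_fun [set: 'rV[T2]_n] (fun x : 'rV[T2]_n => x ord0 i).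
Proof.
move=> _ A mA; apply: sub_sigma_algebra.
case: n i => [[] []//|n i].
rewrite -bigcup_mkord_ord; exists i; first exact: ltn_ord.
by exists A => //; rewrite inord_val.
Qed.

End measurable_rV_theory.



Section lebesgue_rV.
Context {R : realType}.

Definition rV_cons n (p : measurableTypeR R * 'rV[R]_n) : 'rV[R]_n.+1 :=
  row_mx (const_mx p.1 : 'rV[R]_1) p.2.

Definition rV_uncons n (x : 'rV[R]_n.+1) : measurableTypeR R * 'rV[R]_n :=
  (x ord0 ord0, \row_i x ord0 (lift ord0 i)).

Lemma rV_cons0 n (p : measurableTypeR R * 'rV[R]_n) :
  rV_cons p ord0 ord0 = p.1.
Proof.
have /esym := row_mxEl (const_mx p.1 : 'rV[R]_1) p.2 ord0 ord0.
rewrite mxE => ->.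
by congr (fun_of_matrix _ _ _); apply/val_inj.
Qed.

Lemma rV_consS n (p : measurableTypeR R * 'rV[R]_n) (i : 'I_n) :
  rV_cons p ord0 (lift ord0 i) = p.2 ord0 i.
Proof.
have /esym -> := row_mxEr (const_mx p.1 : 'rV[R]_1) p.2 ord0 i.
by congr (fun_of_matrix _ _ _); apply/val_inj.
Qed.

Lemma rV_consK n : cancel (@rV_cons n) (@rV_uncons n).
Proof.
move=> [a x]; rewrite /rV_uncons rV_cons0; congr pair.
by apply/rowP => i; rewrite mxE rV_consS.
Qed.

Lemma measurable_rV_cons n : measurable_fun setT (@rV_cons n).
Proof.
apply/measurable_fun_rVP => i; have [j ->|->] := unliftP ord0 i.
  under eq_fun do rewrite rV_consS.
  exact: (measurableT_comp (@measurable_rV_coord _ R n j) measurable_snd).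
by under eq_fun do rewrite rV_cons0; exact: measurable_fst.
Qed.

Lemma measurable_rV_uncons n : measurable_fun setT (@rV_uncons n).
Proof.
apply: measurable_fun_pair; first exact: measurable_rV_coord.
apply/measurable_fun_rVP => i.
under eq_fun do rewrite mxE.
exact: measurable_rV_coord.
Qed.

Section step.
Local Open Scope ereal_scope.
Context {n : nat} (mu : {sigma_finite_measure set 'rV[R]_n -> \bar R}).

Definition lebesgue_rV_step : set 'rV[R]_n.+1 -> \bar R :=
  pushforward (lebesgue_measure \x mu) (@rV_cons n).

Let mcons A : measurable A -> measurable (@rV_cons n @^-1` A).
Proof.
by move=> mA; rewrite -[X in measurable X]setTI; exact: measurable_rV_cons.
Qed.

Let step0 : lebesgue_rV_step set0 = 0.
Proof. by rewrite /lebesgue_rV_step /pushforward preimage_set0 measure0. Qed.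

Let step_ge0 A : 0 <= lebesgue_rV_step A.
Proof. exact: (measure_ge0 (lebesgue_measure \x mu)%E). Qed.

Let step_sigma_additive : semi_sigma_additive lebesgue_rV_step.
Proof.
move=> F mF tF mUF; rewrite /lebesgue_rV_step /pushforward preimage_bigcup.
apply: measure_semi_sigma_additive.
- by move=> k; exact: mcons.
- apply/trivIsetP => /= i j _ _ ij; rewrite -preimage_setI.
  by move/trivIsetP : tF => /(_ _ _ _ _ ij) ->//; rewrite preimage_set0.
- by rewrite -preimage_bigcup; exact: mcons.
Qed.

HB.instance Definition _ := isMeasure.Build _ _ _ lebesgue_rV_step
  step0 step_ge0 step_sigma_additive.

Let step_sigma_finite : sigma_finite setT lebesgue_rV_step.
Proof.
have /sigma_finiteP[F [TF ndF Foo]] := sigma_finiteT (@lebesgue_measure R).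
have /sigma_finiteP[G [TG ndG Goo]] := sigma_finiteT mu.
exists (fun k => @rV_uncons n @^-1` (F k `*` G k)).
  rewrite -preimage_bigcup; apply/seteqP; split=> // x _ /=.
  have [i _ Fi] : (\bigcup_k F k) (rV_uncons x).1 by rewrite -TF.
  have [j _ Gj] : (\bigcup_k G k) (rV_uncons x).2 by rewrite -TG.
  exists (maxn i j) => //; split.
    by move: Fi; exact/subsetPset/ndF/leq_maxl.
  by move: Gj; exact/subsetPset/ndG/leq_maxr.
move=> k; have [mFk Fk] := Foo k; have [mGk Gk] := Goo k.
have mFG : measurable (F k `*` G k) by exact: measurableX.
split; first by rewrite -[X in measurable X]setTI; exact: measurable_rV_uncons.
rewrite /lebesgue_rV_step /pushforward -comp_preimage.
rewrite (_ : _ \o _ = id); last by apply/funext => p /=; exact: rV_consK.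
by rewrite preimage_id product_measure1E// lte_mul_pinfty// ge0_fin_numE.
Qed.

HB.instance Definition _ := @Measure_isSigmaFinite.Build _ _ _
  lebesgue_rV_step step_sigma_finite.

End step.

(* Lebesgue measure on R^n: the n-fold product of lebesgue_measure, the first
   factor being attached to coordinate 0. It is normalised by lebesgue_rV_box. *)
Fixpoint lebesgue_rV (n : nat) : {sigma_finite_measure set 'rV[R]_n -> \bar R} :=
  match n with
  | 0 => \d_(0 : 'rV[R]_0)
  | n'.+1 => lebesgue_rV_step (lebesgue_rV n')
  end.

Lemma lebesgue_rV_box n (A : 'I_n -> set R) : (forall i, measurable (A i)) ->
  lebesgue_rV n [set x | forall i, A i (x ord0 i)] =
  (\prod_(i < n) lebesgue_measure (A i))%E.
Proof.
elim: n A => [|n IHn] A mA.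
  by rewrite big_ord0 /= diracE mem_set//= => -[].
pose B := [set x : 'rV[R]_n | forall i, A (lift ord0 i) (x ord0 i)].
have mB : measurable B.
  rewrite (_ : B = \bigcap_(i in [set: 'I_n])
      ((fun x : 'rV[R]_n => x ord0 i) @^-1` A (lift ord0 i))).
    apply: fin_bigcap_measurable => // i _.
    by rewrite -[X in measurable X]setTI; exact: measurable_rV_coord.
  by apply/seteqP; split=> x /= Bx i; [move=> _|]; exact: Bx.
rewrite big_ord_recl -IHn// -product_measure1E//=.
rewrite /lebesgue_rV_step /pushforward; congr (_ _).
apply/seteqP; split=> -[a x] /=.
  by move=> Ax; split=> [|i]; [have := Ax ord0|have := Ax (lift ord0 i)];
    rewrite ?rV_cons0 ?rV_consS.
move=> [Aa Ax] i; have [j ->|->] := unliftP ord0 i.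
  by rewrite rV_consS; exact: Ax.
  by rewrite rV_cons0.
exact: mA.
Qed.

(* Euclidean norm; the library norm `|x| on 'rV[R]_n is the sup norm. *)
Definition enorm n (x : 'rV[R]_n) : R := Num.sqrt (\sum_i x ord0 i ^+ 2).

End lebesgue_rV.

Section complex_functions.
Local Notation Re := (@complex.Re _).
Local Notation Im := (@complex.Im _).
Context {R : realType} {n : nat}.
Implicit Types f g : 'rV[R]_n -> R[i].

Definition cmeasurable f :=
  measurable_fun setT (Re \o f) /\ measurable_fun setT (Im \o f).

Definition cLnorm (p : \bar R) f : \bar R :=
  ('N[lebesgue_rV n]_p[EFin \o (@normc R \o f)])%E.

Definition cLp (p : \bar R) f := cmeasurable f /\ (cLnorm p f < +oo)%E.

(* Both integrals are total: this is the usual complex integral only when Re f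
   and Im f are integrable. *)
Definition cintegral f : R[i] :=
  (\int[lebesgue_rV n]_x Re (f x))
    +i* (\int[lebesgue_rV n]_x Im (f x)).

Definition convolution f g (x : 'rV[R]_n) : R[i] :=
  cintegral (fun y => f y * g (x - y)).

Definition cmodulus f (x : 'rV[R]_n) : R[i] := (normc (f x))%:C.

Definition wavelet f := [/\ cLp 1%:E f, cLp 2%:E f & cintegral f = 0].

(* The two dilations are normalised differently: L^2 for the continuous one,
   L^1 for the dyadic one. *)
Definition dilate_cont (psi : 'rV[R]_n -> R[i]) (lambda : R) (x : 'rV[R]_n) : R[i] :=
  (lambda `^ (- (n%:R / 2)))%:C * psi (lambda^-1 *: x).

Definition dilate_dyad (psi : 'rV[R]_n -> R[i]) (j : int) (x : 'rV[R]_n) : R[i] :=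
  ((2 : R) ^ (- (n%:Z * j)))%:C * psi ((2 : R) ^ (- j) *: x).

(* A modulus follows every convolution except the last one. *)
Fixpoint cascade f (ws : seq ('rV[R]_n -> R[i])) : 'rV[R]_n -> R[i] :=
  match ws with
  | [::] => f
  | [:: w] => convolution f w
  | w :: ws' => cascade (cmodulus (convolution f w)) ws'
  end.

Definition S_cont2 m psi f (lambda : 'rV[R]_m) : \bar R :=
  cLnorm 2%:E (cascade f [seq dilate_cont psi (lambda ord0 i) | i <- enum 'I_m]).

Definition S_dyad2 m psi f (j : 'rV[int]_m) : \bar R :=
  cLnorm 2%:E (cascade f [seq dilate_dyad psi (j ord0 i) | i <- enum 'I_m]).

End complex_functions.

Arguments S_cont2 {R n} m psi f lambda.
Arguments S_dyad2 {R n} m psi f j.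

Section target_spaces.
Local Open Scope ereal_scope.
Context {R : realType}.

Definition orthant m : set 'rV[R]_m := [set l | forall i, (0 < l ord0 i)%R].

(* Square integrability on R_+^m for \prod_i dlambda_i / lambda_i^(n+1), where n is
   the dimension of the space on which the wavelet lives. *)
Definition L2_orthant n m (F : 'rV[R]_m -> \bar R) :=
  measurable_fun (@orthant m) F /\
  \int[lebesgue_rV m]_(l in @orthant m)
    (`|F l| ^+ 2 * (\prod_(i < m) (l ord0 i ^- n.+1)%R)%:E) < +oo.

Definition l2_int m (F : 'rV[int]_m -> \bar R) :=
  \esum_(j in [set: 'rV[int]_m]) `|F j| ^+ 2 < +oo.

End target_spaces.

(* Main.v *)
(* Everything rests on the L^2 bound of a square function over dyadic scales,
   sum_i ||f * psi_(2^i t)||^2 <= K ||f||^2 with L^1-normalised dilations and K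
   independent of t > 0 and of the number of scales.  It is proved without the
   Fourier transform, by almost orthogonality (Cotlar--Stein): psi has mean zero,
   a finite moment of small order d, and an L^1 modulus of continuity of order d,
   so ||psi~_s * psi_t||_1 <= C min(s/t, t/s)^d, where psi~(x) = psi(-x), and
   Schur's test applies to these geometrically decaying norms.  The dyadic case
   for m = 1 follows; in the continuous case one integrates the bound over t in
   [1, 2) against dt/t, since (0, oo) is a disjoint union of dyadic blocks.  For
   general m one inducts on the number of layers, the modulus preserving the L^2
   norm.  Complex convolutions are expanded into four real ones. *)
Require Import Defs.
From HB Require Import structures.
From mathcomp Require Import all_boot all_order all_algebra.
From mathcomp Require Import complex.
From mathcomp Require Import all_classical all_reals all_analysis measurable_realfun.
From mathcomp Require Import ring lra zify.
Import Order.TTheory GRing.Theory Num.Theory.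
Import numFieldNormedType.Exports.
Import ComplexField Normc.
Local Open Scope classical_set_scope.
Local Open Scope ring_scope.
Set Implicit Arguments.
Unset Strict Implicit.
Unset Printing Implicit Defensive.

(** * Integration on R^n *)

(** Young's inequality bounds every scale by the same multiple of the norm of [f], which says
    nothing about a sum over many scales; only the interaction of different scales gives a bound
    free of their number. For s <= t the function at scale s has mean zero and sees the one at scale
    t as nearly constant: its moment, of size s^d, meets a modulus of continuity of size t^(-d). For
    s > t the roles are exchanged. This is why decay and smoothness are brought to one common
    exponent d. Kernels are kept bounded and integrable, so their convolution with a square
    integrable function converges at every point, and adjointness and associativity are exact
    identities without null sets. Only squared norms are estimated, and bilinear terms are bounded
    by arithmetic means. The weight of the continuous norm matches the normalisation: an
    L^2-normalised dilation is lambda^(n/2) times the L^1-normalised one, so the squared norm gains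
    lambda^n and d lambda / lambda^(n+1) becomes the scale-invariant d lambda / lambda. *)

Lemma measurable_rVD d (T : measurableType d) (R : realType) n
    (f g : T -> 'rV[R]_n) :
  measurable_fun setT f -> measurable_fun setT g ->
  measurable_fun setT (fun x => f x + g x).
Proof.
move=> /measurable_fun_rVP mf /measurable_fun_rVP mg.
apply/measurable_fun_rVP => i; under eq_fun do rewrite mxE.
exact: measurable_funD.
Qed.

Lemma measurable_rVZ d (T : measurableType d) (R : realType) n
    (k : T -> R) (f : T -> 'rV[R]_n) :
  measurable_fun setT k -> measurable_fun setT f ->
  measurable_fun setT (fun x => k x *: f x).
Proof.
move=> mk /measurable_fun_rVP mf.
apply/measurable_fun_rVP => i; under eq_fun do rewrite mxE.
exact: measurable_funM.
Qed.

Lemma measurable_rVN d (T : measurableType d) (R : realType) n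
    (f : T -> 'rV[R]_n) :
  measurable_fun setT f -> measurable_fun setT (fun x => - f x).
Proof.
move=> /measurable_fun_rVP mf.
apply/measurable_fun_rVP => i; under eq_fun do rewrite mxE.
exact: measurableT_comp.
Qed.

Lemma measurable_rVB d (T : measurableType d) (R : realType) n
    (f g : T -> 'rV[R]_n) :
  measurable_fun setT f -> measurable_fun setT g ->
  measurable_fun setT (fun x => f x - g x).
Proof. by move=> mf mg; apply: measurable_rVD => //; exact: measurable_rVN. Qed.

Lemma measurable_enorm (R : realType) n : measurable_fun setT (@enorm R n).
Proof.
rewrite (_ : @enorm R n = fun x => (\sum_i x ord0 i ^+ 2) `^ 2^-1); last first.
  by apply/funext => x; rewrite powR12_sqrt// sumr_ge0// => i _; exact: sqr_ge0.
apply: (@measurableT_comp _ _ _ _ _ _ (fun t : R => t `^ 2^-1) _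
  (fun x : 'rV[R]_n => \sum_i x ord0 i ^+ 2)).
  exact: measurable_powR.
by apply: measurable_sum => i; apply: measurable_funX; exact: measurable_rV_coord.
Qed.

(** Inversion is continuous only away from 0, so the point 0, which is sent to 0, is split off. *)
Lemma measurable_inv (R : realType) : measurable_fun setT (@GRing.inv R).
Proof.
rewrite (_ : setT = [set 0] `|` [set~ 0] :> set R); last by rewrite setUv.
apply/measurable_funU => //; first exact: measurableC.
split; first by apply: measurable_fun_set1.
apply: open_continuous_measurable_fun.
  by rewrite openC; apply: closed_eq.
by move=> x; rewrite inE/= => /eqP x0; apply: inv_continuous.
Qed.

Section lebesgue_rV_integral.
Context {R : realType}.
Local Open Scope ereal_scope.

(** Tonelli along coordinate 0, [lebesgue_rV] being the push-forward of a product. It drives two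
    kinds of induction: on the dimension of the space, and on the number of layers, whose scales
    also form a row vector. *)
Lemma lebesgue_rV_integralS n (F : 'rV[R]_n.+1 -> \bar R) :
  measurable_fun setT F -> (forall x, 0 <= F x) ->
  \int[lebesgue_rV n.+1]_x F x =
  \int[lebesgue_measure]_t \int[lebesgue_rV n]_x F (rV_cons (t, x)).
Proof.
move=> mF F0.
transitivity (\int[(lebesgue_measure \x lebesgue_rV n)%E]_p F (rV_cons p)).
  by rewrite (@ge0_integral_pushforward _ _ _ _ _ _ (@measurable_rV_cons R n)).
rewrite (fubini_tonelli1 (F \o @rV_cons R n))//.
  exact: (measurableT_comp mF (@measurable_rV_cons R n)).
by move=> x; exact: F0.
Qed.

(** Lebesgue measure is characterised by its values on intervals open on the left and closed on the
    right, so only their preimages are computed; a negative [c] makes these closed on the left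
    instead, which does not change the length. *)
Lemma integral_lebesgue_affine (c a : R) (F : R -> \bar R) : c != 0%R ->
  measurable_fun setT F -> (forall x, 0 <= F x) ->
  \int[lebesgue_measure]_t F (c * t + a)%R =
  (`|c|^-1)%:E * \int[lebesgue_measure]_t F t.
Proof.
move=> c0 mF F0.
pose phi : measurableTypeR R -> measurableTypeR R := fun t => (c * t + a)%R.
have mphi : measurable_fun setT phi.
  by apply: measurable_funD => //; exact: mulrl_measurable.
have absc0 : (0 < `|c|)%R by rewrite normr_gt0.
have phiE A : measurable A -> lebesgue_measure A =
    mscale (NngNum (normr_ge0 c)) (pushforward lebesgue_measure phi) A.
  pose mphi' := isMeasurableFun.Build _ _ _ _ _ mphi.
  pose phi' : {mfun _ >-> _} := HB.pack phi mphi'.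
  apply: (@lebesgue_measure_unique R
    (mscale (NngNum (normr_ge0 c)) (pushforward lebesgue_measure phi'))).
  move=> _ [[u v]] _ <- /=.
  rewrite /mscale/= /pushforward /phi.
  have [cgt0|clt0] := ltrP 0%R c.
    rewrite (_ : _ @^-1` _ = `]((u - a) / c)%R, ((v - a) / c)%R]%classic); last first.
      apply/seteqP; split=> t /=; rewrite !in_itv/= ltr_pdivrMr// ler_pdivlMr//;
      rewrite ltrBlDr lerBrDr mulrC//.
    rewrite !lebesgue_measure_itv/= !lte_fin ltr_pM2r ?invr_gt0// ltrD2r.
    case: ifPn => uv; last by rewrite mule0.
    by rewrite -!EFinD -EFinM; congr EFin; rewrite gtr0_norm//; field.
  have {}clt0 : (c < 0)%R by rewrite lt_neqAle c0.
  rewrite (_ : _ @^-1` _ = `[((v - a) / c)%R, ((u - a) / c)%R[%classic); last first.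
    apply/seteqP; split=> t /=; rewrite !in_itv/= ltr_ndivlMr// ler_ndivrMr//;
    rewrite ltrBlDr lerBrDr mulrC andbC//.
  rewrite !lebesgue_measure_itv/= !lte_fin ltr_nM2r ?invr_lt0// ltrD2r.
  case: ifPn => uv; last by rewrite mule0.
  by rewrite -!EFinD -EFinM; congr EFin; rewrite ltr0_norm//; field.
rewrite [in RHS](eq_measure_integral
  (mscale (NngNum (normr_ge0 c)) (pushforward lebesgue_measure phi))); last first.
  by move=> A mA _; exact: phiE.
rewrite ge0_integral_mscale//= muleA -EFinM mulVf ?gt_eqF// mul1e.
by rewrite (@ge0_integral_pushforward _ _ _ _ _ _ mphi).
Qed.

(** Translation, reflection and dilation are all instances. The induction on the dimension works
    because the map acts separately on coordinate 0 and on the others. *)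
Lemma lebesgue_rV_affine n (c : R) (a : 'rV[R]_n) (F : 'rV[R]_n -> \bar R) :
  c != 0%R -> measurable_fun setT F -> (forall x, 0 <= F x) ->
  \int[lebesgue_rV n]_x F (c *: x + a)%R =
  (`|c|^-1 ^+ n)%:E * \int[lebesgue_rV n]_x F x.
Proof.
move=> c0; elim: n => [|n IHn] in a F *; move=> mF F0.
  rewrite expr0 mul1e; apply: eq_integral => x _.
  by congr F; apply/rowP; case.
have maff : measurable_fun setT (fun x : 'rV[R]_n.+1 => c *: x + a)%R.
  apply: measurable_rVD => //; exact: measurable_rVZ.
have mFcons : measurable_fun setT (F \o @rV_cons R n).
  exact: (measurableT_comp mF (@measurable_rV_cons R n)).
pose H t := \int[lebesgue_rV n]_x F (rV_cons (t, x)).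
have mH : measurable_fun setT H.
  apply: (@measurable_fun_fubini_tonelli_F _ _ _ _ _ (lebesgue_rV n) (F \o @rV_cons R n)) => //.
  by move=> x; exact: F0.
have H0 t : 0 <= H t by exact: integral_ge0.
rewrite !lebesgue_rV_integralS//; last first.
  exact: (measurableT_comp mF maff).
pose a' : 'rV[R]_n := (\row_i a ord0 (lift ord0 i))%R.
have consE t x : (c *: rV_cons (t, x) + a)%R =
  rV_cons ((c * t + a ord0 ord0)%R, (c *: x + a')%R).
  have entryE u i : ((c *: u + a) ord0 i = c * u ord0 i + a ord0 i)%R by rewrite !mxE.
  apply/rowP => i; rewrite entryE; have [j ->|->] := unliftP ord0 i.
    by rewrite !rV_consS/= !mxE.
  by rewrite !rV_cons0.
transitivity (\int[lebesgue_measure]_t ((`|c|^-1 ^+ n)%:E * H (c * t + a ord0 ord0)%R)).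
  apply: eq_integral => t _; under eq_integral do rewrite consE.
  rewrite (IHn a' (fun x => F (rV_cons ((c * t + a ord0 ord0)%R, x))))//.
  exact: (measurableT_comp mFcons (pair1_measurable _)).
rewrite -/H; clearbody H; rewrite ge0_integralZl//.
- by rewrite integral_lebesgue_affine// muleA -EFinM -exprSr.
- apply: (@measurableT_comp _ _ _ _ _ _ H _ (fun t : R => c * t + a ord0 ord0)%R) => //.
  by apply: measurable_funD => //; exact: mulrl_measurable.
Qed.

Lemma lebesgue_rV_shift n (a : 'rV[R]_n) (F : 'rV[R]_n -> \bar R) :
  measurable_fun setT F -> (forall x, 0 <= F x) ->
  \int[lebesgue_rV n]_x F (x + a)%R = \int[lebesgue_rV n]_x F x.
Proof.
move=> mF F0; under eq_integral do rewrite -[x in (x + _)%R]scale1r.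
by rewrite lebesgue_rV_affine ?oner_eq0// normr1 invr1 expr1n mul1e.
Qed.

Lemma lebesgue_rV_subl n (a : 'rV[R]_n) (F : 'rV[R]_n -> \bar R) :
  measurable_fun setT F -> (forall x, 0 <= F x) ->
  \int[lebesgue_rV n]_x F (a - x)%R = \int[lebesgue_rV n]_x F x.
Proof.
move=> mF F0; under eq_integral do rewrite addrC -scaleN1r.
by rewrite lebesgue_rV_affine ?oppr_eq0 ?oner_eq0// normrN normr1 invr1 expr1n mul1e.
Qed.

Local Open Scope ring_scope.

Lemma continuous_powR_1norm (p : R) : continuous (fun t : R => (1 + `|t|) `^ p).
Proof.
move=> t; apply: (@continuous_comp _ _ _ (fun t : R => 1 + `|t|) (fun u => u `^ p)).
  apply: cvgD; [exact: cvg_cst|exact: norm_continuous].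
apply/differentiable_continuous/derivable1_diffP/derivable_powR.
by rewrite in_itv/= andbT ltr_pwDl.
Qed.

Lemma integral_1norm_powR_lty (d : R) : 0 < d ->
  (\int[lebesgue_measure]_t (((1 + `|t|) `^ (- 1 - d))%:E : \bar R) < +oo)%E.
Proof.
move=> d0; rewrite ge0_symfun_integralT//; last 2 first.
- exact: continuous_powR_1norm.
- by move=> t /=; rewrite normrN.
rewrite lte_mul_pinfty// -set_itvcy.
(* The primitive of (1 + t)^(-1 - d) on the half-line that tends to 0 at infinity. *)
pose F (t : R) := - d^-1 * (1 + t) `^ (- d).
have dF (x : R) : 0 <= x -> is_derive x 1 F ((1 + x) `^ (- 1 - d)).
  move=> x0; have x1 : 0 < 1 + x by rewrite ltr_pwDl.
  have -> : (1 + x) `^ (- 1 - d) = - d^-1 *: ((- d * (1 + x) `^ (- d - 1)) *: (0 + 1)).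
    rewrite add0r /GRing.scale/= mulr1 mulrA mulrNN mulVf ?gt_eqF// mul1r.
    by congr (_ `^ _); rewrite addrC.
  rewrite /F.
  have -> : (fun t : R => - d^-1 * (1 + t) `^ (- d)) =
    - d^-1 *: ((fun u => u `^ (- d)) \o (fun t : R => 1 + t)).
    by [].
  apply: is_deriveZ.
  apply: is_derive1_comp.
  exact: is_derive1_powR.
rewrite (@ge0_continuous_FTC2y _ _ F 0 0).
- by rewrite ltey.
- by move=> x _; exact: powR_ge0.
- apply: continuous_subspaceT; exact: continuous_powR_1norm.
- apply/cvgrPdist_lt => e e0; near=> t.
  have t0 : 0 < 1 + t by rewrite ltr_pwDl//; near: t; exact: nbhs_pinfty_ge.
  rewrite sub0r normrN /F normrM normrN !gtr0_norm ?invr_gt0 ?powR_gt0//.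
  rewrite mulrC ltr_pdivrMr// powRN.
  rewrite invf_plt ?posrE ?powR_gt0 ?mulr_gt0//.
  (* Writing the threshold as a d-th power turns the claim into a lower bound on t. *)
  have -> : (e * d)^-1 = ((e * d)^-1 `^ d^-1) `^ d.
    by rewrite -powRrM mulVf ?gt_eqF// powRr1// invr_ge0 mulr_ge0 ?ltW.
  rewrite gt0_ltr_powR ?nnegrE ?powR_ge0 ?ltW//.
  rewrite -ltrBlDl; near: t; apply: nbhs_pinfty_gt; exact: num_real.
- by move=> x x0; apply: ex_derive; apply: dF; exact: ltW.
- apply: cvg_at_right_filter; apply: differentiable_continuous; apply/derivable1_diffP.
  by apply: ex_derive; apply: dF.
- move=> x; rewrite in_itv/= andbT => x0; rewrite derive1E.
  by rewrite (@derive_val _ _ _ _ _ _ _ (dF x (ltW x0))) gtr0_norm.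
Unshelve. all: by end_near. Qed.

Lemma lebesgue_rV_prod_lty n (g : R -> R) : measurable_fun setT g ->
  (forall t, 0 <= g t) -> (\int[lebesgue_measure]_t ((g t)%:E : \bar R) < +oo)%E ->
  (\int[lebesgue_rV n]_x (\prod_i g (x ord0 i))%:E < +oo)%E.
Proof.
move=> mg g0 goo; elim: n => [|n IHn].
  under eq_integral do rewrite big_ord0.
  by rewrite integral_cst//= diracT mule1 ltry.
have mprod k : measurable_fun setT (fun x : 'rV[R]_k => \prod_i g (x ord0 i)).
  apply: measurable_prod => i _; apply: (measurableT_comp mg).
  exact: measurable_rV_coord.
have prod0 k (x : 'rV[R]_k) : (0 <= (\prod_i g (x ord0 i))%:E)%E.
  by rewrite lee_fin; apply: prodr_ge0.
rewrite lebesgue_rV_integralS//.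
under eq_integral => t _.
  under eq_integral => x _.
    rewrite big_ord_recl rV_cons0; under eq_bigr do rewrite rV_consS.
    rewrite /= EFinM; over.
  rewrite ge0_integralZl//.
  over.
- by apply/measurable_EFinP; exact: mprod.
- by move=> x _; exact: prod0.
- by rewrite lee_fin.
rewrite ge0_integralZr//.
- have gi0 : (0 <= \int[lebesgue_measure]_t ((g t)%:E : \bar R))%E.
    by apply: integral_ge0 => t _; rewrite lee_fin.
  by apply: lte_mul_pinfty => //; rewrite ge0_fin_numE.
- exact/measurable_EFinP.
- by move=> t _; rewrite lee_fin.
- by apply: integral_ge0 => x _; exact: prod0.
- by apply/measurable_EFinP; exact: mprod.
Qed.

Lemma ler_coord_enorm n (x : 'rV[R]_n) i : `|x ord0 i| <= enorm x.
Proof.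
rewrite -sqrtr_sqr ler_sqrt ?sqr_ge0//; last first.
  by apply: sumr_ge0 => j _; exact: sqr_ge0.
by rewrite (bigD1 i)//= lerDl; apply: sumr_ge0 => j _; exact: sqr_ge0.
Qed.

Lemma enorm_ge0 n (x : 'rV[R]_n) : 0 <= enorm x.
Proof. exact: sqrtr_ge0. Qed.

Lemma enormZ n (c : R) (x : 'rV[R]_n) : enorm (c *: x) = `|c| * enorm x.
Proof.
rewrite /enorm -sqrtr_sqr -sqrtrM ?sqr_ge0// mulr_sumr.
by congr Num.sqrt; apply: eq_bigr => i _; rewrite mxE exprMn.
Qed.

Lemma enormN n (x : 'rV[R]_n) : enorm (- x) = enorm x.
Proof. by rewrite -scaleN1r enormZ normrN normr1 mul1r. Qed.

Lemma enorm0 n : enorm (0 : 'rV[R]_n) = 0.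
Proof. by rewrite -(scale0r 0) enormZ normr0 mul0r. Qed.

(** No polar coordinates: (1 + |x|)^(-n - d) is a product of n factors (1 + |x|)^(-1 - d/n), and
    each is at most (1 + |x_i|)^(-1 - d/n), because |x_i| <= |x| and the exponent is negative. The
    resulting product is integrated one coordinate at a time. *)
Lemma integral_enorm_powR_lty n (d : R) : (0 < n)%N -> 0 < d ->
  (\int[lebesgue_rV n]_x ((1 + enorm x) `^ (- n%:R - d))%:E < +oo)%E.
Proof.
move=> n0 d0; have nR0 : 0 < n%:R :> R by rewrite ltr0n.
pose p : R := - 1 - d / n%:R; pose g (t : R) := (1 + `|t|) `^ p.
have pE : - n%:R - d = p * n%:R.
  by rewrite /p mulrBl mulNr mul1r divfK ?gt_eqF.
have mg : measurable_fun setT g.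
  apply: continuous_measurable_fun; exact: continuous_powR_1norm.
have : (\int[lebesgue_rV n]_x (\prod_i g (x ord0 i))%:E < +oo)%E.
  apply: lebesgue_rV_prod_lty => //; first by move=> t; exact: powR_ge0.
  by apply: integral_1norm_powR_lty; exact: divr_gt0.
apply: le_lt_trans; apply: ge0_le_integral => //.
- by move=> x _; rewrite lee_fin powR_ge0.
- apply/measurable_EFinP.
  apply: (@measurableT_comp _ _ _ _ _ _ (fun t : R => t `^ (- n%:R - d)) _
    (fun x : 'rV[R]_n => 1 + enorm x)).
    exact: measurable_powR.
  by apply: measurable_funD => //; exact: measurable_enorm.
- apply/measurable_EFinP; apply: measurable_prod => i _.
  by apply: (measurableT_comp mg); exact: measurable_rV_coord.
move=> x _; rewrite lee_fin pE powRrM powR_mulrn ?powR_ge0//.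
rewrite -[n in _ ^+ n]card_ord -prodr_const; apply: ler_prod => i _.
rewrite powR_ge0/= /g.
have x1 : 0 < 1 + `|x ord0 i| by rewrite ltr_pwDl.
have e1 : 0 < 1 + enorm x by rewrite ltr_pwDl// enorm_ge0.
rewrite -(opprK p) powRN [leRHS]powRN lef_pV2 ?posrE ?powR_gt0//.
rewrite ge0_ler_powR ?nnegrE ?(ltW x1) ?(ltW e1) ?lerD2l ?ler_coord_enorm//.
by rewrite /p opprD opprK addr_ge0// opprK ltW// divr_gt0.
Qed.

Lemma lebesgue_rV_integral_subl n (a : 'rV[R]_n) (F : 'rV[R]_n -> \bar R) :
  measurable_fun setT F ->
  (\int[lebesgue_rV n]_x F (a - x)%R = \int[lebesgue_rV n]_x F x)%E.
Proof.
move=> mF; rewrite [LHS]integralE [RHS]integralE.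
congr (_ - _)%E.
  transitivity (\int[lebesgue_rV n]_x F^\+%E (a - x)%R)%E;
    first by apply: eq_integral => x _; rewrite !(funeposE, funenegE).
  by apply: lebesgue_rV_subl => //; exact: measurable_funepos.
transitivity (\int[lebesgue_rV n]_x F^\-%E (a - x)%R)%E;
  first by apply: eq_integral => x _; rewrite !(funeposE, funenegE).
  by apply: lebesgue_rV_subl => //; exact: measurable_funeneg.
Qed.

Lemma lebesgue_rV_integral_shift n (a : 'rV[R]_n) (F : 'rV[R]_n -> \bar R) :
  measurable_fun setT F ->
  (\int[lebesgue_rV n]_x F (x + a)%R = \int[lebesgue_rV n]_x F x)%E.
Proof.
move=> mF; rewrite [LHS]integralE [RHS]integralE.
congr (_ - _)%E.
  transitivity (\int[lebesgue_rV n]_x F^\+%E (x + a)%R)%E;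
    first by apply: eq_integral => x _; rewrite !(funeposE, funenegE).
  by apply: lebesgue_rV_shift => //; exact: measurable_funepos.
transitivity (\int[lebesgue_rV n]_x F^\-%E (x + a)%R)%E;
  first by apply: eq_integral => x _; rewrite !(funeposE, funenegE).
  by apply: lebesgue_rV_shift => //; exact: measurable_funeneg.
Qed.

(** Integrability lets the factor distribute over the difference of the integrals of the positive
    and negative parts. *)
Lemma lebesgue_rV_integral_affine n (c : R) (a : 'rV[R]_n) (F : 'rV[R]_n -> \bar R) :
  c != 0 -> (lebesgue_rV n).-integrable setT F ->
  (\int[lebesgue_rV n]_x F (c *: x + a)%R =
   (`|c|^-1 ^+ n)%:E * \int[lebesgue_rV n]_x F x)%E.
Proof.
move=> c0 iF; have mF := measurable_int _ iF.
have mFp : measurable_fun setT F^\+%E by exact: measurable_funepos.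
have mFn : measurable_fun setT F^\-%E by exact: measurable_funeneg.
rewrite [LHS]integralE [in RHS]integralE muleBr//; last first.
  by apply: fin_num_adde_defr; exact: integrable_pos_fin_num.
congr (_ - _)%E.
  transitivity (\int[lebesgue_rV n]_x F^\+%E (c *: x + a)%R)%E;
    first by apply: eq_integral => x _; rewrite !(funeposE, funenegE).
  exact: lebesgue_rV_affine.
transitivity (\int[lebesgue_rV n]_x F^\-%E (c *: x + a)%R)%E;
  first by apply: eq_integral => x _; rewrite !(funeposE, funenegE).
  exact: lebesgue_rV_affine.
Qed.

End lebesgue_rV_integral.

(** * Real convolutions and the Cotlar--Stein bound *)

(** Tonelli applies to the positive and negative parts separately; where the integral is infinite,
    [fine] returns its default value and is still measurable. *)
Lemma measurable_Rintegral_param d1 d2 (T1 : measurableType d1)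
    (T2 : measurableType d2) (R : realType)
    (mu : {sigma_finite_measure set T2 -> \bar R}) (U : T1 * T2 -> R) :
  measurable_fun setT U ->
  measurable_fun setT (fun t => \int[mu]_y U (t, y)).
Proof.
move=> mU; rewrite /Rintegral.
apply: (@measurableT_comp _ _ _ _ _ _ (@fine R) _
  (fun t => \int[mu]_y (U (t, y))%:E)%E); first exact: fine_measurable.
have mEU : measurable_fun setT (EFin \o U) by exact/measurable_EFinP.
rewrite (_ : (fun _ => _) = (fun t => \int[mu]_y ((EFin \o U)^\+ (t, y))
    - \int[mu]_y ((EFin \o U)^\- (t, y)))%E); last first.
  apply/funext => t; rewrite integralE; congr (_ - _)%E;
  by apply: eq_integral => y _; rewrite !(funeposE, funenegE).
apply: emeasurable_funB.
  apply: (@measurable_fun_fubini_tonelli_F _ _ _ _ _ mu (EFin \o U)^\+%E) => //.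
  exact: measurable_funepos.
apply: (@measurable_fun_fubini_tonelli_F _ _ _ _ _ mu (EFin \o U)^\-%E) => //.
exact: measurable_funeneg.
Qed.

Section real_convolution.
Context {R : realType} {n : nat}.
Local Notation X := 'rV[R]_n.
Local Notation mu := (@lebesgue_rV R n).
Implicit Types f g h a b phi : X -> R.

Definition square_integrable f :=
  measurable_fun setT f /\ (\int[mu]_x (f x ^+ 2)%:E < +oo)%E.

(** Such a kernel is also square integrable, so [rconvolution f phi x] converges absolutely at every
    [x] when [f] is square integrable. The class is stable under reflection, dilation and
    convolution, which is all that almost orthogonality requires of it. *)
Definition bounded_L1 phi := [/\ measurable_fun setT phi,
  exists B, forall x, `|phi x| <= B & (\int[mu]_x `|phi x|%:E < +oo)%E].

Definition rconvolution f g x : R := \int[mu]_y (f y * g (x - y)).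

(** The kernel of the adjoint of convolution with [phi]; see [rconvolution_adjoint]. *)
Definition reflect phi (x : X) : R := phi (- x).

Lemma measurable_reflected x f : measurable_fun setT f ->
  measurable_fun setT (fun y : X => f (x - y)).
Proof. by move=> mf; apply: (measurableT_comp mf); exact: measurable_rVB. Qed.

Lemma measurable_shift x f : measurable_fun setT f ->
  measurable_fun setT (fun y : X => f (y - x)).
Proof. by move=> mf; apply: (measurableT_comp mf); exact: measurable_rVB. Qed.

Lemma measurable_difference f : measurable_fun setT f ->
  measurable_fun setT (fun p : X * X => f (p.1 - p.2)).
Proof. by move=> mf; apply: (measurableT_comp mf); exact: measurable_rVB. Qed.

Lemma square_integrableP f : square_integrable f ->
  mu.-integrable setT (fun x => (f x ^+ 2)%:E).
Proof.
move=> [mf foo]; apply/integrableP; split.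
  by apply/measurable_EFinP; exact: measurable_funX.
by under eq_integral do rewrite gee0_abs ?lee_fin ?sqr_ge0//.
Qed.

Lemma bounded_L1P phi : bounded_L1 phi -> mu.-integrable setT (EFin \o phi).
Proof.
by move=> [mf _ foo]; apply/integrableP; split; first exact/measurable_EFinP.
Qed.

Lemma integrable_square_mul f g : square_integrable f -> square_integrable g ->
  mu.-integrable setT (EFin \o (fun x => f x * g x)).
Proof.
move=> lf lg.
have := integrableD measurableT (square_integrableP lf) (square_integrableP lg).
apply: le_integrable => //.
  by apply/measurable_EFinP; apply: measurable_funM; [case: lf|case: lg].
move=> x _ /=; rewrite lee_fin [leRHS]ger0_norm ?addr_ge0 ?sqr_ge0//.
have := sqr_ge0 (f x - g x); have := sqr_ge0 (f x + g x).
by rewrite ler_norml; nra.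
Qed.

Lemma bounded_L1_square phi : bounded_L1 phi -> square_integrable phi.
Proof.
move=> Kphi; have [mf [B fB] foo] := Kphi; split => //.
have B0 : 0 <= B by exact: le_trans (normr_ge0 _) (fB 0).
apply: (@le_lt_trans _ _ (\int[mu]_x (B%:E * `|phi x|%:E))%E).
  apply: ge0_le_integral => //.
  - by move=> x _; rewrite lee_fin sqr_ge0.
  - by apply/measurable_EFinP; exact: measurable_funX.
  - apply/measurable_EFinP; apply: measurable_funM => //.
    exact: measurableT_comp.
  - move=> x _; rewrite -EFinM lee_fin -real_normK ?num_real// expr2.
    by rewrite ler_wpM2r.
rewrite ge0_integralZl//.
- by rewrite lte_mul_pinfty// lee_fin.
- by apply/measurable_EFinP; exact: measurableT_comp.
Qed.

Lemma bounded_L1_reflected x phi : bounded_L1 phi ->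
  bounded_L1 (fun y : X => phi (x - y)).
Proof.
move=> [mf [B fB] foo]; split; [exact: measurable_reflected|by exists B|].
rewrite (@lebesgue_rV_subl _ _ x (fun y => `|phi y|%:E))//.
by apply/measurable_EFinP; exact: measurableT_comp.
Qed.

Lemma bounded_L1_reflect phi : bounded_L1 phi -> bounded_L1 (reflect phi).
Proof.
move=> /(bounded_L1_reflected 0); congr bounded_L1.
by apply/funext => y; rewrite /reflect sub0r.
Qed.

Lemma integrable_rconvolution f phi x :
  square_integrable f -> bounded_L1 phi ->
  mu.-integrable setT (EFin \o (fun y => f y * phi (x - y))).
Proof.
move=> lf kphi; apply: integrable_square_mul => //.
exact/bounded_L1_square/bounded_L1_reflected.
Qed.

Lemma measurable_rconvolution f phi :
  measurable_fun setT f -> measurable_fun setT phi ->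
  measurable_fun setT (rconvolution f phi).
Proof.
move=> mf mphi.
apply: (@measurable_Rintegral_param _ _ _ _ _ mu
  (fun p : X * X => f p.2 * phi (p.1 - p.2))).
by apply: measurable_funM; [exact: measurableT_comp|exact: measurable_difference].
Qed.

Lemma tonelli_difference a b :
  measurable_fun setT a -> measurable_fun setT b ->
  (forall x, 0 <= a x) -> (forall x, 0 <= b x) ->
  (\int[mu]_x \int[mu]_y (a (x - y) * b y)%:E =
   (\int[mu]_x (a x)%:E) * \int[mu]_x (b x)%:E)%E.
Proof.
move=> ma mb a0 b0.
rewrite (fubini_tonelli (fun p : X * X => (a (p.1 - p.2) * b p.2)%:E))/=; last 2 first.
- apply/measurable_EFinP; apply: measurable_funM;
  [exact: measurable_difference|exact: measurableT_comp].
- by move=> p; rewrite lee_fin mulr_ge0.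
transitivity (\int[mu]_y ((\int[mu]_x (a x)%:E) * (b y)%:E))%E.
  apply: eq_integral => y _; under eq_integral do rewrite EFinM.
  rewrite ge0_integralZr//.
  - rewrite (@lebesgue_rV_shift _ _ (- y) (fun x => (a x)%:E))//.
    exact/measurable_EFinP.
  - by apply/measurable_EFinP; exact: measurable_shift.
  - by move=> x _; rewrite lee_fin.
  - by rewrite lee_fin.
rewrite ge0_integralZl//.
- exact/measurable_EFinP.
- by move=> y _; rewrite lee_fin.
- by apply: integral_ge0 => x _; rewrite lee_fin.
Qed.

Lemma tonelli_difference_outer a b :
  measurable_fun setT a -> measurable_fun setT b ->
  (forall x, 0 <= a x) -> (forall x, 0 <= b x) ->
  (\int[mu]_x \int[mu]_y (a (x - y) * b x)%:E =
   (\int[mu]_x (a x)%:E) * \int[mu]_x (b x)%:E)%E.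
Proof.
move=> ma mb a0 b0.
transitivity (\int[mu]_x ((\int[mu]_y (a y)%:E) * (b x)%:E))%E.
  apply: eq_integral => x _; under eq_integral do rewrite EFinM.
  rewrite ge0_integralZr//.
  - rewrite (@lebesgue_rV_subl _ _ x (fun x => (a x)%:E))//.
    exact/measurable_EFinP.
  - by apply/measurable_EFinP; exact: measurable_reflected.
  - by move=> y _; rewrite lee_fin.
  - by rewrite lee_fin.
rewrite ge0_integralZl//.
- exact/measurable_EFinP.
- by move=> y _; rewrite lee_fin.
- by apply: integral_ge0 => x _; rewrite lee_fin.
Qed.

Local Notation L1 a := (\int[mu]_x `|a x|%:E)%E.
Local Notation SQ a := (\int[mu]_x (a x ^+ 2)%:E)%E.

Lemma L1_ge0 a : (0 <= L1 a)%E.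
Proof. by apply: integral_ge0 => x _; rewrite lee_fin. Qed.

Lemma SQ_ge0 a : (0 <= SQ a)%E.
Proof. by apply: integral_ge0 => x _; rewrite lee_fin sqr_ge0. Qed.

(** Apply 2|h||g| <= h^2 + g^2 under the kernel |k(x - y)|; each of the two terms then factors by
    Tonelli. Half the sum of the squared norms replaces the product of the norms, and this is the
    form that Schur's test consumes. *)
Lemma integral_normM_le h k g :
  square_integrable h -> square_integrable g -> bounded_L1 k ->
  (\int[mu]_x \int[mu]_y `|h x * (k (x - y) * g y)|%:E <=
   2^-1%:E * (L1 k * (SQ g + SQ h)))%E.
Proof.
move=> [mh hoo] [mg goo] [mk _ koo].
have mk' : measurable_fun setT (fun x => `|k x|) by exact: measurableT_comp.
have mg2 : measurable_fun setT (fun x => g x ^+ 2) by exact: measurable_funX.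
have mh2 : measurable_fun setT (fun x => h x ^+ 2) by exact: measurable_funX.
pose U1 (p : X * X) := `|k (p.1 - p.2)| * g p.2 ^+ 2.
pose U2 (p : X * X) := `|k (p.1 - p.2)| * h p.1 ^+ 2.
have mU1 : measurable_fun setT U1.
  apply: measurable_funM; first exact: (@measurable_difference (fun x => `|k x|)).
  exact: (measurableT_comp mg2).
have mU2 : measurable_fun setT U2.
  apply: measurable_funM; first exact: (@measurable_difference (fun x => `|k x|)).
  exact: (measurableT_comp mh2).
have U10 p : 0 <= U1 p by rewrite mulr_ge0 ?sqr_ge0.
have U20 p : 0 <= U2 p by rewrite mulr_ge0 ?sqr_ge0.
have mW : measurable_fun setT (fun p : X * X => `|h p.1 * (k (p.1 - p.2) * g p.2)|).
  apply: measurableT_comp => //; apply: measurable_funM.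
    exact: (measurableT_comp mh).
  apply: measurable_funM; first exact: measurable_difference.
  exact: (measurableT_comp mg).
have W0 (p : X * X) : (0 <= `|h p.1 * (k (p.1 - p.2) * g p.2)|%:E)%E by rewrite lee_fin.
rewrite -(fubini_tonelli1
  (fun p : X * X => `|h p.1 * (k (p.1 - p.2) * g p.2)|%:E))//;
    last exact/measurable_EFinP.
apply: (@le_trans _ _ (\int[mu \x mu]_p (2^-1%:E * ((U1 p)%:E + (U2 p)%:E)))%E).
  apply: ge0_le_integral => //.
  - exact/measurable_EFinP.
  - by apply/measurable_EFinP; apply: measurable_funM => //; exact: measurable_funD.
  - move=> p _; rewrite -EFinD -EFinM lee_fin /U1 /U2 !normrM.
    rewrite -(real_normK (num_real (g p.2))) -(real_normK (num_real (h p.1))).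
    have := sqr_ge0 (`|g p.2| - `|h p.1|).
    have := normr_ge0 (k (p.1 - p.2)).
    by move: `|k _| `|g _| `|h _| => x y z; nra.
rewrite ge0_integralZl//; last first.
- by move=> p _; rewrite adde_ge0// lee_fin.
- by apply: emeasurable_funD; exact/measurable_EFinP.
rewrite ge0_integralD//; last first.
- exact/measurable_EFinP.
- by move=> p _; rewrite lee_fin.
- exact/measurable_EFinP.
- by move=> p _; rewrite lee_fin.
rewrite (fubini_tonelli1 (EFin \o U1))//; last exact/measurable_EFinP.
rewrite (fubini_tonelli1 (EFin \o U2))//; last exact/measurable_EFinP.
rewrite /fubini_F /U1 /U2 /=.
rewrite (@tonelli_difference (fun x => `|k x|) (fun x => g x ^+ 2))//; last first.
  by move=> x; exact: sqr_ge0.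
rewrite (@tonelli_difference_outer (fun x => `|k x|) (fun x => h x ^+ 2))//; last first.
  by move=> x; exact: sqr_ge0.
have -> : (L1 k * (SQ g + SQ h) = L1 k * SQ g + L1 k * SQ h)%E.
  by rewrite ge0_muleDr ?SQ_ge0.
by [].
Qed.

(** The exchange behind both the adjoint relation and associativity; [integral_normM_le] supplies
    the absolute convergence that Fubini asks for. *)
Lemma rconvolution_fubini g h k :
  square_integrable g -> square_integrable h -> bounded_L1 k ->
  \int[mu]_x (h x * rconvolution g k x) =
  \int[mu]_y (g y * \int[mu]_x (k (x - y) * h x)).
Proof.
move=> lg lh kk; have [mg goo] := lg; have [mh hoo] := lh; have [mk _ koo] := kk.
pose U (p : X * X) := h p.1 * (k (p.1 - p.2) * g p.2).
have mU : measurable_fun setT U.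
  apply: measurable_funM; first exact: (measurableT_comp mh).
  apply: measurable_funM; first exact: measurable_difference.
  exact: (measurableT_comp mg).
have iU : (mu \x mu)%E.-integrable setT (EFin \o U).
  apply/integrable12ltyP; first exact/measurable_EFinP.
  apply: le_lt_trans (integral_normM_le lh lg kk) _.
  apply: lte_mul_pinfty => //; apply: lte_mul_pinfty => //.
  - exact: L1_ge0.
  - by rewrite ge0_fin_numE//; exact: L1_ge0.
  - exact: lte_add_pinfty.
rewrite /Rintegral; congr fine.
transitivity (\int[mu]_x \int[mu]_y (EFin \o U) (x, y))%E.
  apply: eq_integral => x _; rewrite /= /rconvolution.
  have ig : mu.-integrable setT (EFin \o (fun y => g y * k (x - y))).
    exact: integrable_rconvolution.
  rewrite -RintegralZl// /Rintegral fineK.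
    by apply: eq_integral => y _; rewrite /U/= (mulrC (g y)).
  have := integrableZl measurableT (h x) ig.
  under eq_fun do rewrite -EFinM.
  exact: integrable_fin_num.
rewrite (Fubini iU); apply: eq_integral => y _.
have ih : mu.-integrable setT (EFin \o (fun x => k (x - y) * h x)).
  have := integrable_rconvolution y lh (bounded_L1_reflect kk).
  by congr (_.-integrable _ _); apply/funext => x; rewrite /= /reflect opprB mulrC.
rewrite -RintegralZl// /Rintegral fineK.
  by apply: eq_integral => x _; rewrite /U/= mulrC -mulrA mulrCA.
have := integrableZl measurableT (g y) ih.
under eq_fun do rewrite -EFinM.
exact: integrable_fin_num.
Qed.

Lemma rconvolution_adjoint f g k :
  square_integrable g -> square_integrable f -> bounded_L1 k ->
  \int[mu]_x (f x * rconvolution g (reflect k) x) =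
  \int[mu]_x (g x * rconvolution f k x).
Proof.
move=> lg lf kk; rewrite (rconvolution_fubini lg lf (bounded_L1_reflect kk)).
apply: eq_Rintegral => y _; congr (_ * _).
by apply: eq_Rintegral => x _; rewrite /reflect opprB mulrC.
Qed.

Lemma rconvolutionA g a b : square_integrable g -> bounded_L1 a ->
  bounded_L1 b ->
  rconvolution (rconvolution g a) b = rconvolution g (rconvolution a b).
Proof.
move=> lg ka kb; apply/funext => x.
have lb : square_integrable (fun y => b (x - y)).
  exact/bounded_L1_square/bounded_L1_reflected.
rewrite [LHS]/rconvolution.
under eq_Rintegral do rewrite mulrC.
(* Associativity at x is the exchange tested against the function y -> b(x - y), which is square
   integrable; a shift by z then recentres the inner integral. *)
rewrite (rconvolution_fubini lg lb ka); apply: eq_Rintegral => z _; congr (_ * _).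
rewrite /rconvolution /Rintegral; congr fine.
rewrite -[LHS](@lebesgue_rV_integral_shift _ _ z (fun u => (a (u - z) * b (x - u))%:E)).
  by apply: eq_integral => u _; rewrite addrK opprD addrA addrAC.
apply/measurable_EFinP; apply: measurable_funM; first by apply: measurable_shift;
  case: ka.
by apply: measurable_reflected; case: kb.
Qed.

Lemma rconvolutionC a b : measurable_fun setT a -> measurable_fun setT b ->
  rconvolution a b = rconvolution b a.
Proof.
move=> ma mb; apply/funext => x; rewrite /rconvolution /Rintegral; congr fine.
rewrite -[LHS](@lebesgue_rV_integral_subl _ _ x (fun u => (a u * b (x - u))%:E)).
  by apply: eq_integral => u _; rewrite subKr mulrC.
by apply/measurable_EFinP; apply: measurable_funM => //; exact: measurable_reflected.
Qed.


Lemma le_norm_rconvolution f k x :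
  mu.-integrable setT (EFin \o (fun y => f y * k (x - y))) ->
  (`|rconvolution f k x|%:E <= \int[mu]_y (`|f y| * `|k (x - y)|)%:E)%E.
Proof.
move=> i; rewrite EFin_normr_Rintegral//.
under [leRHS]eq_integral do rewrite -normrM.
exact: (le_abse_integral _ measurableT (measurable_int _ i)).
Qed.

(** The pointwise form of Young's inequality: Cauchy--Schwarz for the measure |k(x - y)| dy, whose
    mass is at most [N]. *)
Lemma sqr_rconvolution_le f k x (N : R) :
  square_integrable f -> bounded_L1 k -> 0 < N -> (L1 k <= N%:E)%E ->
  ((rconvolution f k x ^+ 2)%:E <=
   N%:E * \int[mu]_y (`|k (x - y)| * f y ^+ 2)%:E)%E.
Proof.
move=> lf kk N0 LN; have [mf foo] := lf; have [mk [B kB] koo] := kk.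
have mkx : measurable_fun setT (fun y : X => `|k (x - y)|).
  by apply: measurableT_comp => //; exact: measurable_reflected.
have mf2 : measurable_fun setT (fun x => f x ^+ 2) by exact: measurable_funX.
have mfn : measurable_fun setT (fun x => `|f x|) by exact: measurableT_comp.
set I := rconvolution f k x; set Q := (\int[mu]_y _)%E.
have Q0 : (0 <= Q)%E.
  by apply: integral_ge0 => y _; rewrite lee_fin mulr_ge0 ?sqr_ge0.
(* Cauchy--Schwarz, from [2 c |f| <= f ^+ 2 + c ^+ 2] at the optimal [c]. *)
pose c := `|I| / N; have c0 : 0 <= c by rewrite divr_ge0// ltW.
have Lx : (\int[mu]_y `|k (x - y)|%:E = L1 k)%E.
  rewrite (@lebesgue_rV_subl _ _ x (fun y => `|k y|%:E))//.
  by apply/measurable_EFinP; exact: measurableT_comp.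
have : ((2 * c)%:E * `|I|%:E <= Q + (c ^+ 2)%:E * N%:E)%E.
  apply: (@le_trans _ _ ((2 * c)%:E * \int[mu]_y (`|f y| * `|k (x - y)|)%:E)%E).
    have c20 : 0 <= 2 * c by rewrite mulr_ge0.
    apply: lee_pmul; rewrite ?lee_fin//.
    exact/le_norm_rconvolution/integrable_rconvolution.
  apply: (@le_trans _ _ (Q + (c ^+ 2)%:E * L1 k)%E); last first.
    by rewrite leeD2l// lee_pmul ?L1_ge0// lee_fin sqr_ge0.
  have -> : ((2 * c)%:E * \int[mu]_y (`|f y| * `|k (x - y)|)%:E =
      \int[mu]_y ((2 * c)%:E * (`|f y| * `|k (x - y)|)%:E))%E.
    rewrite ge0_integralZl//.
    - by apply/measurable_EFinP; exact: measurable_funM.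
    - by rewrite lee_fin mulr_ge0.
  have -> : ((c ^+ 2)%:E * L1 k = \int[mu]_y ((c ^+ 2)%:E * `|k (x - y)|%:E))%E.
    rewrite -Lx ge0_integralZl//; first exact/measurable_EFinP.
    by rewrite lee_fin sqr_ge0.
  rewrite -ge0_integralD//; last 4 first.
  - by move=> y _; rewrite lee_fin mulr_ge0 ?sqr_ge0.
  - by apply/measurable_EFinP; exact: measurable_funM.
  - by move=> y _; rewrite mule_ge0// lee_fin sqr_ge0.
  - by apply/measurable_EFinP; exact: measurable_funM.
  apply: ge0_le_integral => //.
  - by move=> y _; apply: mule_ge0; rewrite lee_fin mulr_ge0.
  - by apply/measurable_EFinP; do 2 apply: measurable_funM => //.
  - by apply/measurable_EFinP; apply: measurable_funD; exact: measurable_funM.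
  - move=> y _; rewrite -!EFinM -EFinD lee_fin -(real_normK (num_real (f y))).
    have := sqr_ge0 (`|f y| - c); have := normr_ge0 (k (x - y)).
    by move: `|k _| `|f _| => u v; nra.
(* If [Q] is infinite, so is the right-hand side, because [N] is positive. *)
case: Q Q0 => [q| |]//= q0; last by move=> _; rewrite gt0_muley// leey.
rewrite -!EFinM -EFinD !lee_fin => H.
have <- : `|I| ^+ 2 = I ^+ 2 by rewrite real_normK ?num_real.
have E : c * N = `|I| by rewrite /c divfK// gt_eqF.
rewrite -E; rewrite -E in H; nra.
Qed.

Lemma square_integrable_rconvolution f k :
  square_integrable f -> bounded_L1 k -> square_integrable (rconvolution f k).
Proof.
move=> lf kk; have [mf foo] := lf; have [mk [B kB] koo] := kk.
have mc : measurable_fun setT (rconvolution f k) by exact: measurable_rconvolution.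
have mk' : measurable_fun setT (fun x => `|k x|) by exact: measurableT_comp.
have mf2 : measurable_fun setT (fun x => f x ^+ 2) by exact: measurable_funX.
split => //.
have L1fin : L1 k \is a fin_num by rewrite ge0_fin_numE// L1_ge0.
(* The added 1 keeps [N] positive even when the L^1 norm of [k] is 0. *)
pose N := fine (L1 k) + 1.
have LN : (L1 k <= N%:E)%E by rewrite /N EFinD fineK// leeDl.
have N0 : 0 < N by rewrite ltr_wpDl// fine_ge0// L1_ge0.
have mU : measurable_fun setT (fun p : X * X => `|k (p.1 - p.2)| * f p.2 ^+ 2).
  apply: measurable_funM; first exact: (@measurable_difference (fun x => `|k x|)).
  exact: (measurableT_comp mf2).
have U0 (x y : X) : (0 <= (`|k (x - y)| * f y ^+ 2)%:E)%E.
  by rewrite lee_fin mulr_ge0 ?sqr_ge0.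
have mQ : measurable_fun setT (fun x : X => \int[mu]_y (`|k (x - y)| * f y ^+ 2)%:E)%E.
  apply: (@measurable_fun_fubini_tonelli_F _ _ _ _ _ mu
    (fun p : X * X => (`|k (p.1 - p.2)| * f p.2 ^+ 2)%:E)).
    exact/measurable_EFinP.
  by move=> p; exact: U0.
apply: (@le_lt_trans _ _ (\int[mu]_x (N%:E * \int[mu]_y (`|k (x - y)| * f y ^+ 2)%:E))%E).
  apply: ge0_le_integral => //.
  - by move=> x _; rewrite lee_fin sqr_ge0.
  - by apply/measurable_EFinP; exact: measurable_funX.
  - exact: emeasurable_funM.
  - by move=> x _; exact: sqr_rconvolution_le.
rewrite ge0_integralZl//.
- rewrite (@tonelli_difference (fun x => `|k x|) (fun x => f x ^+ 2))//.
  + apply: lte_mul_pinfty => //; first by rewrite lee_fin ltW.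
    by apply: lte_mul_pinfty => //; exact: L1_ge0.
  + by move=> x; exact: sqr_ge0.
- by move=> x _; exact: integral_ge0.
- by rewrite lee_fin ltW.
Qed.

(** The supremum is at most that of |b| times the L^1 norm of [a], and integrability is Tonelli.
    This admits as kernels the products of two kernels that Cotlar--Stein forms. *)
Lemma bounded_L1_rconvolution a b : bounded_L1 a -> bounded_L1 b ->
  bounded_L1 (rconvolution a b).
Proof.
move=> ka kb; have [ma _ aoo] := ka; have [mb [B bB] boo] := kb.
have ma' : measurable_fun setT (fun x => `|a x|) by exact: measurableT_comp.
have mb' : measurable_fun setT (fun x => `|b x|) by exact: measurableT_comp.
have B0 : 0 <= B by exact: le_trans (normr_ge0 _) (bB 0).
have mc : measurable_fun setT (rconvolution a b) by exact: measurable_rconvolution.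
have iab x : mu.-integrable setT (EFin \o (fun y => a y * b (x - y))).
  by apply: integrable_rconvolution => //; exact: bounded_L1_square.
split => //.
  exists (B * fine (L1 a)) => x; rewrite -lee_fin.
  apply: le_trans (le_norm_rconvolution (iab x)) _.
  rewrite EFinM fineK ?ge0_fin_numE ?L1_ge0// -ge0_integralZl//.
  - apply: ge0_le_integral => //.
    + apply/measurable_EFinP; apply: measurable_funM => //.
      exact: (@measurable_reflected x (fun x => `|b x|)).
    + by apply/measurable_EFinP; exact: measurable_funM.
    + by move=> y _; rewrite -EFinM lee_fin mulrC ler_wpM2r.
  - exact/measurable_EFinP.
apply: (@le_lt_trans _ _ (\int[mu]_x \int[mu]_y (`|b (x - y)| * `|a y|)%:E)%E).
  apply: ge0_le_integral => //.
  - by apply/measurable_EFinP; exact: measurableT_comp.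
  - apply: (@measurable_fun_fubini_tonelli_F _ _ _ _ _ mu
    (fun p : X * X => (`|b (p.1 - p.2)| * `|a p.2|)%:E)).
      apply/measurable_EFinP; apply: measurable_funM;
        first exact: (@measurable_difference (fun x => `|b x|)).
      exact: (measurableT_comp ma').
    by move=> p; rewrite lee_fin.
  - move=> x _; under eq_integral do rewrite mulrC.
    exact: le_norm_rconvolution.
rewrite (@tonelli_difference (fun x => `|b x|) (fun x => `|a x|))//.
by apply: lte_mul_pinfty => //; rewrite ?L1_ge0// ge0_fin_numE// L1_ge0.
Qed.

(* Since [a] has mean zero, [b (w - u)] may be replaced by [b (w - u) - b w] in
   the integral defining [rconvolution a b w]. *)
Lemma L1_rconvolution_le a b (d P Q : R) :
  bounded_L1 a -> bounded_L1 b -> \int[mu]_u a u = 0 -> 0 <= Q ->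
  (\int[mu]_u (`|a u| * enorm u `^ d)%:E <= P%:E)%E ->
  (forall u, (\int[mu]_w `|b (w - u) - b w|%:E <= (Q * enorm u `^ d)%:E)%E) ->
  (L1 (rconvolution a b) <= (P * Q)%:E)%E.
Proof.
move=> ka kb a0 Q0 aP bQ; have [ma _ aoo] := ka; have [mb _ boo] := kb.
have iab x : mu.-integrable setT (EFin \o (fun y => a y * b (x - y))).
  by apply: integrable_rconvolution => //; exact: bounded_L1_square.
have mab : measurable_fun setT (fun p : X * X => a p.2 * (b (p.1 - p.2) - b p.1)).
  apply: measurable_funM; first exact: (measurableT_comp ma).
  apply: measurable_funB; first exact: measurable_difference.
  exact: (measurableT_comp mb).
have mnab : measurable_fun setT (fun p : X * X => `|a p.2 * (b (p.1 - p.2) - b p.1)|).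
  exact: measurableT_comp.
apply: (@le_trans _ _ (\int[mu]_w \int[mu]_u `|a u * (b (w - u) - b w)|%:E)%E).
  apply: ge0_le_integral => //.
  - by apply/measurable_EFinP; apply: measurableT_comp => //;
    exact: measurable_rconvolution.
  - apply: (@measurable_fun_fubini_tonelli_F _ _ _ _ _ mu
    (fun p : X * X => `|a p.2 * (b (p.1 - p.2) - b p.1)|%:E)).
      exact/measurable_EFinP.
    by move=> p; rewrite lee_fin.
  - move=> w _.
    have ia : mu.-integrable setT (EFin \o (fun u => a u * b w)).
      have := integrableZr measurableT (b w) (bounded_L1P ka).
      by congr (_.-integrable _ _); apply/funext => u; rewrite /= EFinM.
    have -> : rconvolution a b w = \int[mu]_u (a u * (b (w - u) - b w)).
      transitivity (\int[mu]_u (a u * b (w - u)) - \int[mu]_u (a u * b w)).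
        by rewrite RintegralZr ?a0 ?mul0r ?subr0//; exact: bounded_L1P.
      by rewrite -RintegralB//; apply: eq_Rintegral => u _; rewrite mulrBr.
    have i : mu.-integrable setT (EFin \o (fun u => a u * (b (w - u) - b w))).
      have := integrableB measurableT (iab w) ia.
      by congr (_.-integrable _ _); apply/funext => u; rewrite /= mulrBr EFinB.
    rewrite EFin_normr_Rintegral//.
    exact: (le_abse_integral _ measurableT (measurable_int _ i)).
rewrite (fubini_tonelli (fun p : X * X => `|a p.2 * (b (p.1 - p.2) - b p.1)|%:E));
  last 2 first.
- exact/measurable_EFinP.
- by move=> p; rewrite lee_fin.
(* With the integrals exchanged, the inner one is |a u| times the modulus of continuity of [b] at
   [u]; what remains is [Q] times the moment of [a]. *)
apply: (@le_trans _ _ (\int[mu]_u (Q%:E * (`|a u| * enorm u `^ d)%:E))%E).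
  apply: ge0_le_integral => //.
  - by move=> u _; exact: integral_ge0.
  - apply: (@measurable_fun_fubini_tonelli_G _ _ _ _ _ mu
    (fun p : X * X => `|a p.2 * (b (p.1 - p.2) - b p.1)|%:E)).
      exact/measurable_EFinP.
    by move=> p; rewrite lee_fin.
  - apply/measurable_EFinP; apply: measurable_funM => //; apply: measurable_funM.
      exact: measurableT_comp.
    apply: (@measurableT_comp _ _ _ _ _ _ (fun t : R => t `^ d)).
      exact: measurable_powR.
    exact: measurable_enorm.
  - move=> u _; under eq_integral do rewrite /= normrM EFinM.
    rewrite ge0_integralZl//.
    + rewrite -EFinM mulrCA EFinM; apply: lee_pmul => //; exact: L1_ge0.
    + apply/measurable_EFinP; apply: measurableT_comp => //.
      by apply: measurable_funB => //; exact: measurable_shift.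
rewrite ge0_integralZl//.
- by rewrite mulrC EFinM; apply: lee_pmul => //; apply: integral_ge0 => u _;
  rewrite lee_fin mulr_ge0 ?powR_ge0.
- apply/measurable_EFinP; apply: measurable_funM; first exact: measurableT_comp.
  apply: (@measurableT_comp _ _ _ _ _ _ (fun t : R => t `^ d)).
    exact: measurable_powR.
  exact: measurable_enorm.
- by move=> u _; rewrite lee_fin mulr_ge0 ?powR_ge0.
Qed.

Lemma integral_mul_rconvolution_le g h k (c : R) :
  square_integrable g -> square_integrable h -> bounded_L1 k ->
  (L1 k <= c%:E)%E ->
  \int[mu]_x (h x * rconvolution g k x) <=
  c * ((\int[mu]_x (g x ^+ 2)) + \int[mu]_x (h x ^+ 2)) / 2.
Proof.
move=> lg lh kk kc.
have lc := square_integrable_rconvolution lg kk.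
have [mg goo] := lg; have [mh hoo] := lh; have [mk _ koo] := kk.
have fg : SQ g \is a fin_num by rewrite ge0_fin_numE ?SQ_ge0.
have fh : SQ h \is a fin_num by rewrite ge0_fin_numE ?SQ_ge0.
have i := integrable_square_mul lh lc.
apply: le_trans (ler_norm _) _.
rewrite -lee_fin EFin_normr_Rintegral//.
apply: le_trans (le_abse_integral _ measurableT (measurable_int _ i)) _.
apply: (@le_trans _ _ (\int[mu]_x \int[mu]_y `|h x * (k (x - y) * g y)|%:E)%E).
  apply: ge0_le_integral => //.
  - by apply: measurableT_comp => //; exact: measurable_int i.
  - apply: (@measurable_fun_fubini_tonelli_F _ _ _ _ _ mu
    (fun p : X * X => `|h p.1 * (k (p.1 - p.2) * g p.2)|%:E)).
      apply/measurable_EFinP; apply: measurableT_comp => //; apply: measurable_funM.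
        exact: (measurableT_comp mh).
      apply: measurable_funM; first exact: measurable_difference.
      exact: (measurableT_comp mg).
    by move=> p; rewrite lee_fin.
  - move=> x _ /=; under eq_integral do rewrite normrM EFinM.
    rewrite ge0_integralZl//.
    + rewrite normrM EFinM; apply: lee_pmul => //.
      under eq_integral do rewrite normrM mulrC.
      exact/le_norm_rconvolution/integrable_rconvolution.
    + apply/measurable_EFinP; apply: measurableT_comp => //.
      by apply: measurable_funM => //; exact: measurable_reflected.
apply: le_trans (integral_normM_le lh lg kk) _.
rewrite mulrC EFinM; apply: lee_pmul => //.
  by rewrite mule_ge0 ?L1_ge0// adde_ge0 ?SQ_ge0.
rewrite EFinM; apply: lee_pmul; [exact: L1_ge0| |exact: kc|].
  by apply: adde_ge0; exact: SQ_ge0.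
by rewrite EFinD /Rintegral !fineK.
Qed.

Lemma square_integrableD f g :
  square_integrable f -> square_integrable g -> square_integrable (fun x => f x + g x).
Proof.
move=> lf lg; have [mf foo] := lf; have [mg goo] := lg.
split; first exact: measurable_funD.
have mf2 : measurable_fun setT (fun x => f x ^+ 2) by exact: measurable_funX.
have mg2 : measurable_fun setT (fun x => g x ^+ 2) by exact: measurable_funX.
apply: (@le_lt_trans _ _ (\int[mu]_x (2%:E * ((f x ^+ 2)%:E + (g x ^+ 2)%:E)))%E).
  apply: ge0_le_integral => //.
  - by move=> x _; rewrite lee_fin sqr_ge0.
  - by apply/measurable_EFinP; apply: measurable_funX; exact: measurable_funD.
  - by apply/measurable_EFinP; apply: measurable_funM => //; exact: measurable_funD.
  - move=> x _; rewrite -EFinD -EFinM lee_fin.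
    by have := sqr_ge0 (f x - g x); nra.
rewrite ge0_integralZl//.
- rewrite ge0_integralD//.
  + by apply: lte_mul_pinfty => //; exact: lte_add_pinfty.
  + by move=> x _; rewrite lee_fin sqr_ge0.
  + exact/measurable_EFinP.
  + by move=> x _; rewrite lee_fin sqr_ge0.
  + exact/measurable_EFinP.
- by apply: emeasurable_funD; exact/measurable_EFinP.
- by move=> x _; rewrite adde_ge0// lee_fin sqr_ge0.
Qed.

Lemma square_integrable0 : square_integrable (fun=> 0).
Proof.
split => //; under eq_integral do rewrite expr0n/=.
by rewrite integral0.
Qed.

Lemma square_integrable_sum (I : Type) (r : seq I) (t : I -> X -> R) :
  (forall i, square_integrable (t i)) -> square_integrable
    (fun x => \sum_(i <- r) t i x).
Proof.
move=> lt; elim: r => [|i r IHr].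
  by under eq_fun do rewrite big_nil; exact: square_integrable0.
by under eq_fun do rewrite big_cons; exact: square_integrableD.
Qed.

Lemma Rintegral_mul_sumr (I : Type) (r : seq I) f (t : I -> X -> R) :
  square_integrable f -> (forall i, square_integrable (t i)) ->
  \int[mu]_x (f x * \sum_(i <- r) t i x) = \sum_(i <- r) \int[mu]_x (f x * t i x).
Proof.
move=> lf lt; elim: r => [|i r IHr].
  rewrite big_nil; under eq_Rintegral do rewrite big_nil mulr0.
  by rewrite /Rintegral integral0.
rewrite big_cons -IHr; under eq_Rintegral do rewrite big_cons mulrDr.
by rewrite RintegralD//; apply: integrable_square_mul => //;
  exact: square_integrable_sum.
Qed.

(* Cotlar--Stein: with [h] the sum of the [rconvolution (g i) (reflect (phi i))],
   where [g i := rconvolution f (phi i)], the inner product of [f] and [h] is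
   the left-hand side [S], and the norm of [h] squared is at most [K * S] by
   Schur's test; the bound is then the nonnegativity of the norm of [f - K^-1 h]. *)
Lemma sum_rconvolution_le (I : finType) (phi : I -> X -> R) (c : I -> I ->
  R) (K : R) f :
  (forall i, bounded_L1 (phi i)) ->
  (forall i j, (L1 (rconvolution (reflect (phi i)) (phi j)) <= (c i j)%:E)%E) ->
  0 < K -> (forall i, \sum_j c i j <= K) -> (forall j, \sum_i c i j <= K) ->
  square_integrable f ->
  \sum_i \int[mu]_x (rconvolution f (phi i) x ^+ 2) <= K * \int[mu]_x (f x ^+ 2).
Proof.
move=> kphi cP K0 Kr Kc lf.
pose g i := rconvolution f (phi i).
have lg i : square_integrable (g i) by exact: square_integrable_rconvolution.
pose t i := rconvolution (g i) (reflect (phi i)).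
have kr i : bounded_L1 (reflect (phi i)) by exact: bounded_L1_reflect.
have lt i : square_integrable (t i) by exact: square_integrable_rconvolution.
pose h x := \sum_i t i x.
have lh : square_integrable h by exact: square_integrable_sum.
pose a i := \int[mu]_x (g i x ^+ 2).
pose S := \sum_i a i.
have a0 i : 0 <= a i by apply: Rintegral_ge0 => x _; exact: sqr_ge0.
rewrite -/S.
have fh : \int[mu]_x (f x * h x) = S.
  rewrite (Rintegral_mul_sumr _ lf lt); apply: eq_bigr => i _.
  rewrite (rconvolution_adjoint (lg i) lf (kphi i)).
  by apply: eq_Rintegral => x _; rewrite expr2.
(* Moving the last reflected kernel to the other side pairs [g j] with [g i] convolved with
   [rconvolution (reflect (phi i)) (phi j)], whose L^1 norm is at most [c i j]. *)
have tt i j : \int[mu]_x (t i x * t j x) <= c i j * (a i + a j) / 2.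
  rewrite (rconvolution_adjoint (lg j) (lt i) (kphi j)) /t rconvolutionA//.
  apply: integral_mul_rconvolution_le => //.
  exact: bounded_L1_rconvolution.
have hh : \int[mu]_x (h x * h x) <= K * S.
  rewrite (Rintegral_mul_sumr _ lh lt).
  apply: (@le_trans _ _ (\sum_j \sum_i (c i j * a i / 2 + c i j * a j / 2))).
    apply: ler_sum => j _; under eq_Rintegral do rewrite mulrC.
    rewrite (Rintegral_mul_sumr _ (lt j) lt); apply: ler_sum => i _.
    under eq_Rintegral do rewrite mulrC.
    by apply: le_trans (tt i j) _; rewrite mulrDr mulrDl.
  under eq_bigr do rewrite big_split/=.
  rewrite big_split/= exchange_big/=.
  (* Schur's test: the row sums of [c] multiply the terms [a i] and the column sums the terms [a j],
     each double sum accounting for half of [K * S]. *)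
  rewrite [leRHS](_ : _ = \sum_i K * a i / 2 + \sum_i K * a i / 2); last first.
    by rewrite -!mulr_suml -mulr_sumr -/S; field.
  apply: lerD; apply: ler_sum => i _; rewrite -!mulr_suml.
    by rewrite !ler_wpM2r.
  by rewrite !ler_wpM2r.
have i1 := integrable_square_mul lf lf.
have i2 := integrable_square_mul lf lh.
have i3 := integrable_square_mul lh lh.
have : 0 <= \int[mu]_x ((f x - K^-1 * h x) ^+ 2).
  by apply: Rintegral_ge0 => x _; exact: sqr_ge0.
have -> : \int[mu]_x ((f x - K^-1 * h x) ^+ 2) =
    \int[mu]_x (f x * f x) - 2 * K^-1 * S + K^-1 ^+ 2 * \int[mu]_x (h x * h x).
  rewrite -fh -!RintegralZl// -RintegralB//; last first.
    by have := integrableZl measurableT (2 * K^-1) i2; under eq_fun do rewrite -EFinM.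
  rewrite -RintegralD//; last 2 first.
  - have := integrableB measurableT i1 (integrableZl measurableT (2 * K^-1) i2).
    by congr (_.-integrable _ _); apply/funext => x; rewrite /= EFinB EFinM.
  - by have := integrableZl measurableT (K^-1 ^+ 2) i3; under eq_fun do rewrite -EFinM.
  by apply: eq_Rintegral => x _; ring.
under [X in _ -> _ <= K * X]eq_Rintegral do rewrite expr2.
move: (\int[mu]_x (f x * f x)) => F H.
(* The factor [K^-1] is the minimiser of F - 2 u S + u^2 K S over u, and the minimum is F - S /
   K. *)
have : 0 <= F - 2 * K^-1 * S + K^-1 ^+ 2 * (K * S).
  by apply: le_trans H _; rewrite lerD2l ler_wpM2l// sqr_ge0.
have -> : K^-1 ^+ 2 * (K * S) = K^-1 * S by field; rewrite gt_eqF.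
rewrite (_ : F - _ + _ = F - K^-1 * S); last by ring.
by rewrite subr_ge0 mulrC ler_pdivrMr// mulrC.
Qed.

End real_convolution.

(** * Dilations and almost orthogonality *)

Section dilations.
Context {R : realType} {n : nat}.
Local Notation X := 'rV[R]_n.
Local Notation mu := (@lebesgue_rV R n).
Implicit Types f g h a b phi : X -> R.

(** [P] controls the moment of order [d] and [Q] the L^1 modulus of continuity of the same order.
    Dilation by [t] multiplies them by t^d and t^(-d), so [P * Q] is scale invariant; this is the
    source of the uniformity in the base scale. *)
Definition cancellative (d P Q : R) phi :=
  [/\ bounded_L1 phi, \int[mu]_x phi x = 0,
      (\int[mu]_u (`|phi u| * enorm u `^ d)%:E <= P%:E)%E, 0 <= Q &
      forall u, (\int[mu]_x `|phi (x - u) - phi x|%:E <= (Q * enorm u `^ d)%:E)%E].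

Definition dilate phi (t : R) (x : X) : R := t ^- n * phi (t^-1 *: x).

Lemma cancellative_ge0 d P Q phi : cancellative d P Q phi -> 0 <= P.
Proof.
move=> [_ _ + _ _]; rewrite -lee_fin; apply: le_trans.
by apply: integral_ge0 => u _; rewrite lee_fin mulr_ge0 ?powR_ge0.
Qed.

Lemma measurable_scaler t phi : measurable_fun setT phi ->
  measurable_fun setT (fun x : X => phi (t *: x)).
Proof. by move=> mphi; apply: (measurableT_comp mphi); exact: measurable_rVZ. Qed.

Lemma measurable_enorm_powR d : measurable_fun setT (fun u : X => enorm u `^ d).
Proof.
apply: (@measurableT_comp _ _ _ _ _ _ (fun t : R => t `^ d)).
  exact: measurable_powR.
exact: measurable_enorm.
Qed.

Lemma cancellative_reflect d P Q phi :
  cancellative d P Q phi -> cancellative d P Q (reflect phi).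
Proof.
move=> [kphi phi0 phiP Q0 phiQ]; have [mphi _ _] := kphi.
have mn : measurable_fun setT (fun x => `|phi x|) by exact: measurableT_comp.
split => //.
- exact: bounded_L1_reflect.
- rewrite -[RHS]phi0 /Rintegral; congr fine.
  rewrite -[RHS](@lebesgue_rV_integral_subl _ _ 0 (EFin \o phi)).
    by apply: eq_integral => x _; rewrite /reflect sub0r.
  exact/measurable_EFinP.
- have -> : (\int[mu]_u (`|reflect phi u| * enorm u `^ d)%:E =
      \int[mu]_u (`|phi (0 - u)%R| * enorm (0 - u)%R `^ d)%:E)%E.
    by apply: eq_integral => u _; rewrite /reflect sub0r enormN.
  rewrite (@lebesgue_rV_subl _ _ 0 (fun u => (`|phi u| * enorm u `^ d)%:E))//.
  + apply/measurable_EFinP; apply: measurable_funM => //; exact: measurable_enorm_powR.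
  + by move=> u; rewrite lee_fin mulr_ge0 ?powR_ge0.
- move=> u; rewrite -enormN; apply: le_trans (phiQ (- u)).
  rewrite -[leRHS](@lebesgue_rV_subl _ _ 0 (fun x => `|phi (x - (- u)) - phi x|%:E))//.
    rewrite le_eqVlt; apply/orP; left; apply/eqP; apply: eq_integral => x _.
    by rewrite /reflect !sub0r opprB opprK (addrC u).
  apply/measurable_EFinP; apply: measurableT_comp => //.
  by apply: measurable_funB => //; exact: measurable_shift.
Qed.

Lemma integral_scale_inv (t : R) (F : X -> \bar R) : 0 < t ->
  measurable_fun setT F -> (forall x, 0 <= F x)%E ->
  (\int[mu]_x F (t^-1 *: x) = (t ^+ n)%:E * \int[mu]_x F x)%E.
Proof.
move=> t0 mF F0; under eq_integral do rewrite -[_ *: _]addr0.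
rewrite lebesgue_rV_affine ?invr_eq0 ?gt_eqF//.
by rewrite gtr0_norm ?invr_gt0// invrK.
Qed.

Lemma bounded_L1_dilate phi t : 0 < t -> bounded_L1 phi -> bounded_L1 (dilate phi t).
Proof.
move=> t0 [mphi [B phiB] phioo]; split.
- apply: measurable_funM => //; exact: measurable_scaler.
- have tn0 : 0 <= t ^- n by rewrite invr_ge0 exprn_ge0// ltW.
  by exists (t ^- n * B) => x; rewrite normrM ger0_norm// ler_wpM2l.
- have tn0 : 0 <= t ^- n by rewrite invr_ge0 exprn_ge0// ltW.
  have mn : measurable_fun setT (fun x => `|phi x|) by exact: measurableT_comp.
  under eq_integral do rewrite normrM EFinM ger0_norm//.
  rewrite ge0_integralZl//.
  + rewrite (@integral_scale_inv _ (fun x => `|phi x|%:E))//;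
    last exact/measurable_EFinP.
    apply: lte_mul_pinfty => //; rewrite ?lee_fin// ; apply: lte_mul_pinfty => //.
    by rewrite lee_fin exprn_ge0// ltW.
  + by apply/measurable_EFinP; exact: (@measurable_scaler _ (fun x => `|phi x|)).
Qed.

Lemma enorm_scale_powR d (t : R) (u : X) : 0 < t ->
  enorm (t^-1 *: u) `^ d = t `^ (- d) * enorm u `^ d.
Proof.
move=> t0; have tge0 := ltW t0.
rewrite enormZ gtr0_norm ?invr_gt0// powRM ?enorm_ge0 ?invr_ge0//.
by rewrite -powR_inv1// -powRrM mulN1r.
Qed.

Lemma cancellative_dilate d P Q phi t : 0 < t -> cancellative d P Q phi ->
  cancellative d (P * t `^ d) (Q * t `^ (- d)) (dilate phi t).
Proof.
move=> t0 [kphi phi0 phiP Q0 phiQ]; have [mphi _ _] := kphi.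
have mn : measurable_fun setT (fun x => `|phi x|) by exact: measurableT_comp.
have tn0 : 0 < t ^+ n by rewrite exprn_gt0.
have tnV0 : 0 <= t ^- n by rewrite invr_ge0 ltW.
have tE (y : \bar R) : ((t ^- n)%:E * ((t ^+ n)%:E * y) = y)%E.
  by rewrite muleA -EFinM mulVf ?gt_eqF// mul1e.
split => //.
- exact: bounded_L1_dilate.
- have i := bounded_L1P kphi.
  rewrite /dilate /Rintegral.
  transitivity (fine (\int[mu]_x ((t ^- n)%:E * (EFin \o phi) (t^-1 *: x + 0)%R)))%E.
    by congr fine; apply: eq_integral => x _; rewrite /= addr0 EFinM.
  rewrite integralZl//.
    rewrite lebesgue_rV_integral_affine ?invr_eq0 ?gt_eqF//.
    rewrite gtr0_norm ?invr_gt0// invrK tE; exact: phi0.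
  have := bounded_L1_dilate t0 kphi.
  move/bounded_L1P/(integrableZl measurableT (t ^+ n)).
  congr (_.-integrable _ _); apply/funext => x.
  by rewrite /= /dilate addr0 -EFinM mulrA mulfV ?mul1r ?gt_eqF.
- have -> : (\int[mu]_u (`|dilate phi t u| * enorm u `^ d)%:E =
      \int[mu]_u ((t ^- n * t `^ d)%:E * (`|phi (t^-1 *: u)| * enorm (t^-1 *: u) `^ d)%:E))%E.
    apply: eq_integral => u _; rewrite -EFinM /dilate normrM (ger0_norm tnV0).
    rewrite enorm_scale_powR// powRN; congr EFin.
    by field; rewrite gt_eqF ?powR_gt0//= expf_neq0 ?gt_eqF.
  have mm : measurable_fun setT (fun u : X => `|phi u| * enorm u `^ d).
    by apply: measurable_funM => //; exact: measurable_enorm_powR.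
  rewrite ge0_integralZl//.
  + rewrite (@integral_scale_inv _ (fun u => (`|phi u| * enorm u `^ d)%:E))//.
    * rewrite mulrC EFinM -muleA tE mulrC EFinM; apply: lee_pmul => //.
        by rewrite lee_fin powR_ge0.
      by apply: integral_ge0 => u _; rewrite lee_fin mulr_ge0 ?powR_ge0.
    * exact/measurable_EFinP.
    * by move=> u; rewrite lee_fin mulr_ge0 ?powR_ge0.
  + by apply/measurable_EFinP; exact: (@measurable_scaler _
    (fun u => `|phi u| * enorm u `^ d)).
  + by move=> u _; rewrite lee_fin mulr_ge0 ?powR_ge0.
  + by rewrite lee_fin mulr_ge0 ?powR_ge0.
- by rewrite mulr_ge0 ?powR_ge0.
- move=> u.
  have md : measurable_fun setT (fun x : X => `|phi (x - t^-1 *: u) - phi x|).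
    by apply: measurableT_comp => //; apply: measurable_funB => //;
      exact: measurable_shift.
  have -> : (\int[mu]_x `|dilate phi t (x - u) - dilate phi t x|%:E =
      \int[mu]_x ((t ^- n)%:E * `|phi (t^-1 *: x - t^-1 *: u) - phi (t^-1 *: x)|%:E))%E.
    apply: eq_integral => x _; rewrite -EFinM /dilate -mulrBr normrM (ger0_norm tnV0).
    by rewrite scalerBr.
  rewrite ge0_integralZl//.
  + rewrite (@integral_scale_inv _ (fun x => `|phi (x - t^-1 *: u) - phi x|%:E))//.
    * rewrite tE; apply: le_trans (phiQ _) _.
      by rewrite lee_fin enorm_scale_powR// mulrA.
    * exact/measurable_EFinP.
  + apply/measurable_EFinP.
    exact: (@measurable_scaler _ (fun x => `|phi (x - t^-1 *: u) - phi x|)).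
Qed.

(** Convolution being commutative, either factor may be the one whose vanishing mean is exploited;
    which bound is the smaller depends on which factor lives at the finer scale. *)
Lemma L1_rconvolution_cancellative d P1 Q1 P2 Q2 a b :
  cancellative d P1 Q1 a -> cancellative d P2 Q2 b ->
  (\int[mu]_x `|rconvolution a b x|%:E <= (Num.min (P1 * Q2) (P2 * Q1))%:E)%E.
Proof.
move=> [ka a0 aP Q10 aQ] [kb b0 bP Q20 bQ].
rewrite /Num.min; case: ifP => _; first exact: L1_rconvolution_le aP bQ.
rewrite rconvolutionC; [|by case: ka|by case: kb].
exact: L1_rconvolution_le bP aQ.
Qed.

(** One of the two truncated differences is always 0, so the exponent is the distance between [i]
    and [j]. The 2 counts the two sides of [i]; this is the row sum for Schur's test, uniform in
    [N]. *)
Lemma sum_geometric_dist_le (r : R) (N i : nat) : 0 < r < 1 ->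
  \sum_(j < N) r ^+ ((j - i) + (i - j)) <= 2 / (1 - r).
Proof.
move=> /andP[r0 r1]; have r10 : 0 < 1 - r by rewrite subr_gt0.
rewrite ler_pdivlMr//.
(* The two differences are truncated: this sharper bound goes through by
   induction on [N] on both sides of [i]. *)
apply: (@le_trans _ _ (r ^+ (i - N) + 1 - r ^+ (N - i))); last first.
  have : r ^+ (i - N) <= 1 by apply: exprn_ile1; exact: ltW.
  have : 0 <= r ^+ (N - i) by rewrite exprn_ge0// ltW.
  by move: (r ^+ _) (r ^+ _) => u v; lra.
elim: N => [|N IHN].
  rewrite big_ord0 mul0r subn0 sub0n expr0 addrK exprn_ge0//; exact: ltW.
rewrite big_ord_recr/= mulrDl; apply: le_trans (lerD IHN (lexx _)) _.
have [iN|Ni] := leqP i N.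
  rewrite subSn// exprS (eqP iN) (eqP (leqW iN : i - N.+1 == 0)%N) addn0.
  by move: (r ^+ (N - i)) => u; lra.
rewrite (eqP (ltnW Ni : N - i == 0)%N) (eqP (Ni : N.+1 - i == 0)%N) add0n -subSS subSn// exprS.
have : 0 <= r ^+ (i - N.+1) by rewrite exprn_ge0// ltW.
move: (r ^+ _) => u u0; rewrite !expr0; have := sqr_ge0 (1 - r); nra.
Qed.

Lemma sum_rconvolution_dilate_le d P Q phi f (t0 : R) (N : nat) :
  0 < d -> cancellative d P Q phi -> square_integrable f -> 0 < t0 ->
  \sum_(i < N) \int[mu]_x (rconvolution f (dilate phi (t0 * 2 ^+ i)) x ^+ 2) <=
  (P * Q * (2 / (1 - 2 `^ (- d))) + 1) * \int[mu]_x (f x ^+ 2).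
Proof.
move=> d0 cphi lf t00; have P0 := cancellative_ge0 cphi.
have Q0 : 0 <= Q by case: cphi.
pose r : R := 2 `^ (- d).
have r01 : 0 < r < 1.
  rewrite powR_gt0//= /r powRN invf_lt1 ?powR_gt0//.
  by have := @gt0_ltr_powR R d d0 1 2; rewrite powR1; apply; rewrite ?nnegrE ?ltr1n.
have rc : 0 <= 2 / (1 - r).
  by rewrite divr_ge0// subr_ge0 ltW//; case/andP: r01.
pose t i : R := t0 * 2 ^+ i.
have tgt0 i : 0 < t i by rewrite mulr_gt0// exprn_gt0.
(* The base scale [t0] cancels here, so the final constant does not depend on it. *)
have tt i j : (i <= j)%N -> t i `^ d * t j `^ (- d) = r ^+ (j - i).
  move=> ij; rewrite /t !powRM ?exprn_ge0 ?ltW//.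
  rewrite -!powR_mulrn ?ler0n// ?ltW ?powR_gt0// -!powRrM natrB//.
  rewrite mulrACA -powRD; last by rewrite (gt_eqF t00) implybT.
  rewrite subrr powRr0 mul1r -powRD; last by rewrite pnatr_eq0 implybT.
  by congr (_ `^ _); ring.
have cd i : cancellative d (P * t i `^ d) (Q * t i `^ (- d)) (dilate phi (t i)).
  exact: cancellative_dilate.
pose c (i j : 'I_N) := P * Q * r ^+ ((j - i) + (i - j)).
(* The added 1 only makes the constant positive when [P * Q] is 0, as [sum_rconvolution_le]
   demands. *)
have csum i : \sum_j c i j <= P * Q * (2 / (1 - r)) + 1.
  rewrite -mulr_sumr; apply: ler_wpDr => //.
  by rewrite ler_wpM2l ?mulr_ge0// sum_geometric_dist_le.
apply: (@sum_rconvolution_le _ _ _ (fun i : 'I_N => dilate phi (t i)) c) => //.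
- by move=> i; case: (cd i).
- move=> i j; have := L1_rconvolution_cancellative (cancellative_reflect (cd i)) (cd j).
  move/le_trans; apply; rewrite lee_fin ge_min /c.
  (* The finer of the two scales supplies the moment and the coarser one the modulus of
     continuity. *)
  have [ij|/ltnW ij] := leqP i j.
    rewrite (eqP (ij : i - j == 0)%N) addn0 -tt//; apply/orP; left.
    by rewrite le_eqVlt; apply/orP; left; apply/eqP; ring.
  rewrite (eqP (ij : j - i == 0)%N) add0n -tt//; apply/orP; right.
  by rewrite le_eqVlt; apply/orP; left; apply/eqP; ring.
- by rewrite ltr_wpDl//; apply: mulr_ge0 => //; exact: mulr_ge0.
- move=> j; apply: le_trans (csum j).
  by apply: ler_sum => i _; rewrite /c addnC.
Qed.

Lemma exists_cancellative phi (A eps eps' : R) : (0 < n)%N ->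
  measurable_fun setT phi -> \int[mu]_x phi x = 0 ->
  0 < A -> 0 < eps -> 0 < eps' ->
  (forall x, `|phi x| <= A * (1 + enorm x) `^ (- n%:R - eps)) ->
  (forall y, y != 0 ->
    (\int[mu]_x `|phi (x - y) - phi x|%:E <= (A * enorm y `^ eps')%:E)%E) ->
  exists d P Q, 0 < d /\ cancellative d P Q phi.
Proof.
move=> n0 mphi phi0 A0 eps0 eps'0 phiA phimod.
have Age0 := ltW A0;
  have dge0 : 0 <= Num.min (eps / 2) eps' by rewrite le_min !ltW// divr_gt0.
have e1 (x : X) : 1 <= 1 + enorm x by rewrite lerDl enorm_ge0.
have e0 (x : X) : 0 < 1 + enorm x by exact: lt_le_trans (e1 x).
have mn : measurable_fun setT (fun x => `|phi x|) by exact: measurableT_comp.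
have mdec p : measurable_fun setT (fun x : X => (1 + enorm x) `^ p).
  apply: (@measurableT_comp _ _ _ _ _ _ (fun t : R => t `^ p) _
    (fun x : X => 1 + enorm x)).
    exact: measurable_powR.
  by apply: measurable_funD => //; exact: measurable_enorm.
(* [d < eps] makes the moment finite; [d <= eps'] preserves the modulus of
   continuity for [enorm u <= 1], and beyond that it is at most twice the norm. *)
pose d := Num.min (eps / 2) eps'.
have d0 : 0 < d by rewrite lt_min divr_gt0.
have dA : d < eps by rewrite gt_min; apply/orP; left; lra.
(* Used twice: at [p = d] for the moment, and at [p = 0] for integrability of [phi]. *)
have moment_lty p : p < eps -> (\int[mu]_u (`|phi u| * (1 + enorm u) `^ p)%:E < +oo)%E.
  move=> peps.
  apply: (@le_lt_trans _ _ (\int[mu]_u (A%:E * ((1 + enorm u) `^ (- n%:R - (eps - p)))%:E))%E).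
    apply: ge0_le_integral => //.
    - by move=> u _; rewrite lee_fin mulr_ge0 ?powR_ge0.
    - by apply/measurable_EFinP; exact: measurable_funM.
    - by apply/measurable_EFinP; exact: measurable_funM.
    - move=> u _; rewrite -EFinM lee_fin.
      apply: le_trans (ler_wpM2r (powR_ge0 _ _) (phiA u)) _.
      rewrite -mulrA -powRD; last by apply/implyP => _; rewrite gt_eqF.
      by have -> : - n%:R - (eps - p) = - n%:R - eps + p by ring.
  rewrite ge0_integralZl//.
  - apply: lte_mul_pinfty => //.
    by apply: integral_enorm_powR_lty; rewrite // subr_gt0.
  - exact/measurable_EFinP.
  - by move=> u _; rewrite lee_fin powR_ge0.
have Loo : (\int[mu]_u `|phi u|%:E < +oo)%E.
  have := moment_lty 0 eps0; congr (_ < _)%E; apply: eq_integral => u _.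
  by rewrite powRr0 mulr1.
have kphi : bounded_L1 phi.
  split => //; exists A => x; apply: le_trans (phiA x) _.
  rewrite ler_piMr// -[leRHS](powRr0 (1 + enorm x)) ler_powR//.
  by rewrite -opprD oppr_le0 addr_ge0// ltW.
(* The weight (1 + |u|)^d dominates |u|^d and has the shape handled by [moment_lty]. *)
pose P := fine (\int[mu]_u (`|phi u| * (1 + enorm u) `^ d)%:E)%E.
pose L := fine (\int[mu]_u `|phi u|%:E)%E.
have L0 : 0 <= L by rewrite fine_ge0// integral_ge0.
exists d, P, (A + 2 * L); split => //; split => //.
- rewrite /P fineK; last first.
    rewrite ge0_fin_numE; first exact: moment_lty.
    by apply: integral_ge0 => u _; rewrite lee_fin mulr_ge0 ?powR_ge0.
  apply: ge0_le_integral => //.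
  + by move=> u _; rewrite lee_fin mulr_ge0 ?powR_ge0.
  + apply/measurable_EFinP; apply: measurable_funM => //; exact: measurable_enorm_powR.
  + by apply/measurable_EFinP; exact: measurable_funM.
  + move=> u _; rewrite lee_fin ler_wpM2l// ge0_ler_powR ?nnegrE ?enorm_ge0 ?lerDr//.
    exact: ltW.
- by rewrite addr_ge0 ?mulr_ge0.
(* The assumed modulus of continuity excludes the zero shift; there both sides vanish, because [d]
   is positive. *)
move=> u; have [->|u0] := eqVneq u 0.
  rewrite enorm0 powR0 ?gt_eqF// mulr0.
  by under eq_integral do rewrite subr0 subrr normr0; rewrite integral0.
have [u1|u1] := leP (enorm u) 1.
  have eu0 : 0 < enorm u.
    rewrite lt_neqAle enorm_ge0 andbT eq_sym; apply: contra u0 => /eqP eu.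
    apply/eqP/rowP => i; rewrite mxE; apply/eqP; rewrite -normr_le0 -eu.
    exact: ler_coord_enorm.
  apply: le_trans (phimod _ u0) _; rewrite lee_fin.
  apply: (@le_trans _ _ (A * enorm u `^ d)).
    rewrite ler_wpM2l// ger_powR ?eu0//.
    by rewrite ge_min lexx orbT.
  by rewrite ler_wpM2r ?powR_ge0// lerDl mulr_ge0.
have LE : (\int[mu]_u `|phi u|%:E = L%:E)%E.
  by rewrite /L fineK// ge0_fin_numE// integral_ge0.
apply: (@le_trans _ _ (2 * L)%:E); last first.
  rewrite lee_fin; apply: (@le_trans _ _ ((2 * L) * enorm u `^ d)).
    by rewrite ler_peMr ?mulr_ge0// -[leLHS](powRr0 (enorm u)) ler_powR// ltW.
  by rewrite ler_wpM2r ?powR_ge0// lerDr.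
apply: (@le_trans _ _ (\int[mu]_x (`|phi (x - u)|%:E + `|phi x|%:E))%E).
  apply: ge0_le_integral => //.
  - apply/measurable_EFinP; apply: measurableT_comp => //.
    by apply: measurable_funB => //; exact: measurable_shift.
  - apply/measurable_EFinP; apply: measurable_funD => //.
    exact: (@measurable_shift _ _ _ (fun x => `|phi x|)).
  - by move=> x _; rewrite -EFinD lee_fin ler_normB.
rewrite ge0_integralD//.
- rewrite (@lebesgue_rV_shift _ _ (- u) (fun x => `|phi x|%:E))//.
    by rewrite LE -EFinD mulr_natl mulr2n.
  exact/measurable_EFinP.
- by apply/measurable_EFinP; exact: (@measurable_shift _ _ _ (fun x => `|phi x|)).
- exact/measurable_EFinP.
Qed.

End dilations.

(** * Complex convolutions *)

Section complex_convolution.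
Context {R : realType} {n : nat}.
Local Notation X := 'rV[R]_n.
Local Notation mu := (@lebesgue_rV R n).
Local Notation Re := (@complex.Re R).
Local Notation Im := (@complex.Im R).
Local Open Scope complex_scope.
Implicit Types f g w psi : X -> R[i].

Lemma normc_sqr (z : R[i]) : normc z ^+ 2 = Re z ^+ 2 + Im z ^+ 2.
Proof. by case: z => a b /=; rewrite sqr_sqrtr// addr_ge0 ?sqr_ge0. Qed.

Lemma normc_nonneg (z : R[i]) : 0 <= normc z.
Proof. by case: z => a b /=; exact: sqrtr_ge0. Qed.

Lemma normrRe_le (z : R[i]) : `|Re z| <= normc z.
Proof.
rewrite -ler_sqr ?nnegrE ?normc_nonneg// normc_sqr real_normK ?num_real//.
by rewrite lerDl sqr_ge0.
Qed.

Lemma normrIm_le (z : R[i]) : `|Im z| <= normc z.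
Proof.
rewrite -ler_sqr ?nnegrE ?normc_nonneg// normc_sqr real_normK ?num_real//.
by rewrite lerDr sqr_ge0.
Qed.

Lemma ReM (z w : R[i]) : Re (z * w) = Re z * Re w - Im z * Im w.
Proof. by case: z; case: w. Qed.

Lemma ImM (z w : R[i]) : Im (z * w) = Re z * Im w + Im z * Re w.
Proof. by case: z; case: w. Qed.

Lemma measurable_normc d (T : measurableType d) (f : T -> R[i]) :
  measurable_fun setT (Re \o f) -> measurable_fun setT (Im \o f) ->
  measurable_fun setT (fun x => normc (f x)).
Proof.
move=> mr mi.
rewrite (_ : (fun x => _) = fun x => (Re (f x) ^+ 2 + Im (f x) ^+ 2) `^ 2^-1).
  apply: (@measurableT_comp _ _ _ _ _ _ (fun t : R => t `^ 2^-1) _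
    (fun x => Re (f x) ^+ 2 + Im (f x) ^+ 2)); first exact: measurable_powR.
  by apply: measurable_funD; exact: measurable_funX.
apply/funext => x; rewrite -normc_sqr powR12_sqrt ?sqr_ge0// sqrtr_sqr ger0_norm//.
exact: normc_nonneg.
Qed.

(** The estimates are run on this squared norm because it is the integral of a nonnegative function,
    to which Tonelli applies; [sqr_cLnorm] links it to [cLnorm]. *)
Definition csqnorm f : \bar R := (\int[mu]_x (normc (f x) ^+ 2)%:E)%E.

Lemma csqnorm_ge0 f : (0 <= csqnorm f)%E.
Proof. by apply: integral_ge0 => x _; rewrite lee_fin sqr_ge0. Qed.

Lemma cLnorm_ge0 f : (0 <= cLnorm 2%:E f)%E.
Proof. exact: Lnorm_ge0. Qed.

Lemma sqr_cLnorm f : (cLnorm 2%:E f ^+ 2 = csqnorm f)%E.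
Proof.
have -> : (cLnorm 2%:E f ^+ 2 = cLnorm 2%:E f `^ 2)%E.
  have := cLnorm_ge0 f; case: (cLnorm 2%:E f) => [r r0| _|]//;
    last by rewrite poweRyr ?pnatr_eq0// expe2 mulyy.
  by rewrite poweR_EFin powR_mulrn// EFin_expe.
rewrite poweR_Lnorm//; apply: eq_integral => x _ /=.
rewrite ger0_norm ?normc_nonneg// powR_mulrn//; exact: normc_nonneg.
Qed.

Lemma cLp2P f : cLp 2%:E f <-> cmeasurable f /\ (csqnorm f < +oo)%E.
Proof.
rewrite /cLp -sqr_cLnorm; have := cLnorm_ge0 f.
case: (cLnorm 2%:E f) => [r _| _ |]//; first by rewrite -EFin_expe !ltry.
all: by split=> -[? //].
Qed.

Lemma cLp2_square_integrable f : cLp 2%:E f ->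
  square_integrable (Re \o f) /\ square_integrable (Im \o f).
Proof.
move/cLp2P => [[mr mi] foo].
have mn : measurable_fun setT (fun x => normc (f x) ^+ 2).
  by apply: measurable_funX; exact: measurable_normc.
split; split => //; apply: le_lt_trans foo; apply: ge0_le_integral => //.
- by move=> x _; rewrite lee_fin sqr_ge0.
- by apply/measurable_EFinP; exact: measurable_funX.
- exact/measurable_EFinP.
- by move=> x _; rewrite lee_fin normc_sqr lerDl sqr_ge0.
- by move=> x _; rewrite lee_fin sqr_ge0.
- by apply/measurable_EFinP; exact: measurable_funX.
- exact/measurable_EFinP.
- by move=> x _; rewrite lee_fin normc_sqr lerDr sqr_ge0.
Qed.

Lemma csqnormE f : cmeasurable f ->
  (csqnorm f = \int[mu]_x (Re (f x) ^+ 2)%:E + \int[mu]_x (Im (f x) ^+ 2)%:E)%E.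
Proof.
move=> [mr mi]; rewrite /csqnorm; under eq_integral do rewrite normc_sqr EFinD.
rewrite ge0_integralD//.
- by move=> x _; rewrite lee_fin sqr_ge0.
- by apply/measurable_EFinP; exact: measurable_funX.
- by move=> x _; rewrite lee_fin sqr_ge0.
- by apply/measurable_EFinP; exact: measurable_funX.
Qed.

Definition cbounded_L1 w := bounded_L1 (Re \o w) /\ bounded_L1 (Im \o w).

Lemma Re_convolution f w x : cLp 2%:E f -> cbounded_L1 w ->
  Re (convolution f w x) =
  rconvolution (Re \o f) (Re \o w) x - rconvolution (Im \o f) (Im \o w) x.
Proof.
move=> /cLp2_square_integrable[lr li] [kr ki].
rewrite /convolution /cintegral /= /rconvolution -RintegralB//.
- by apply: eq_Rintegral => y _; rewrite ReM.
- exact: integrable_rconvolution.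
- exact: integrable_rconvolution.
Qed.

Lemma Im_convolution f w x : cLp 2%:E f -> cbounded_L1 w ->
  Im (convolution f w x) =
  rconvolution (Re \o f) (Im \o w) x + rconvolution (Im \o f) (Re \o w) x.
Proof.
move=> /cLp2_square_integrable[lr li] [kr ki].
rewrite /convolution /cintegral /= /rconvolution -RintegralD//.
- by apply: eq_Rintegral => y _; rewrite ImM.
- exact: integrable_rconvolution.
- exact: integrable_rconvolution.
Qed.

Lemma cmeasurable_convolution f w : cLp 2%:E f -> cbounded_L1 w ->
  cmeasurable (convolution f w).
Proof.
move=> lf kw; have [lr li] := cLp2_square_integrable lf; have [kr ki] := kw.
have m a b : square_integrable a -> bounded_L1 b ->
  measurable_fun setT (@rconvolution R n a b).
  by move=> [? _] [? _ _]; exact: measurable_rconvolution.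
split.
  rewrite (_ : _ \o _ =
    fun x => rconvolution (Re \o f) (Re \o w) x -
      rconvolution (Im \o f) (Im \o w) x); last by apply/funext => x; exact: Re_convolution.
  by apply: measurable_funB; exact: m.
rewrite (_ : _ \o _ =
  fun x => rconvolution (Re \o f) (Im \o w) x + rconvolution (Im \o f) (Re \o w) x);
    last by apply/funext => x; exact: Im_convolution.
by apply: measurable_funD; exact: m.
Qed.

Local Notation SQ a := (\int[mu]_x (a x ^+ 2)%:E)%E.

(** The real and the imaginary part are each a sum or difference of two real convolutions, and (a +
    b)^2 <= 2 (a^2 + b^2): hence the 2. *)
Lemma csqnorm_convolution_le f w : cLp 2%:E f -> cbounded_L1 w ->
  (csqnorm (convolution f w) <= 2%:E *
    ((SQ (rconvolution (Re \o f) (Re \o w)) + SQ (rconvolution (Im \o f) (Im \o w))) +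
     (SQ (rconvolution (Re \o f) (Im \o w)) + SQ (rconvolution (Im \o f) (Re \o w)))))%E.
Proof.
move=> lf kw; have [lr li] := cLp2_square_integrable lf; have [kr ki] := kw.
have m a b : square_integrable a -> bounded_L1 b ->
    measurable_fun setT (fun x => (@rconvolution R n a b x ^+ 2)%:E).
  move=> [? _] [? _ _]; apply/measurable_EFinP; apply: measurable_funX.
  exact: measurable_rconvolution.
have s0 a b x : (0 <= (@rconvolution R n a b x ^+ 2)%:E)%E by rewrite lee_fin sqr_ge0.
rewrite -!ge0_integralD//; first last.
all: try exact: m.
all: try by (move=> x _; exact: adde_ge0).
all: try by (apply: emeasurable_funD; exact: m).
rewrite -ge0_integralZl//; first last.
- by move=> x _; rewrite !adde_ge0.
- by do ![apply: emeasurable_funD]; exact: m.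
apply: ge0_le_integral => //.
- by move=> x _; rewrite lee_fin sqr_ge0.
- apply/measurable_EFinP; apply: measurable_funX.
  by have [] := cmeasurable_convolution lf kw; exact: measurable_normc.
- by apply: emeasurable_funM => //; do ![apply: emeasurable_funD]; exact: m.
move=> x _; rewrite -!EFinD -EFinM lee_fin normc_sqr Re_convolution// Im_convolution//.
move: (rconvolution _ _ _) (rconvolution _ _ _)
  (rconvolution _ _ _) (rconvolution _ _ _) => a b c d.
have := sqr_ge0 (d + c); have := sqr_ge0 (b - a); nra.
Qed.

Lemma cLp2_convolution f w : cLp 2%:E f -> cbounded_L1 w ->
  cLp 2%:E (convolution f w).
Proof.
move=> lf kw; have [lr li] := cLp2_square_integrable lf; have [kr ki] := kw.
apply/cLp2P; split; first exact: cmeasurable_convolution.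
apply: le_lt_trans (csqnorm_convolution_le lf kw) _.
have s a b : square_integrable a -> bounded_L1 b -> (SQ (rconvolution a b) < +oo)%E.
  by move=> la kb; have [] := square_integrable_rconvolution la kb.
by apply: lte_mul_pinfty => //; apply: lte_add_pinfty; apply: lte_add_pinfty; exact: s.
Qed.

Lemma normc_cmodulus f x : normc (cmodulus f x) = normc (f x).
Proof. by rewrite /cmodulus /= expr0n/= addr0 sqrtr_sqr ger0_norm ?normc_nonneg. Qed.

Lemma csqnorm_cmodulus f : csqnorm (cmodulus f) = csqnorm f.
Proof. by apply: eq_integral => x _; rewrite normc_cmodulus. Qed.

Lemma cLp2_cmodulus f : cLp 2%:E f -> cLp 2%:E (cmodulus f).
Proof.
move/cLp2P => [[mr mi] foo]; apply/cLp2P; rewrite csqnorm_cmodulus; split => //.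
split; first exact: measurable_normc.
by rewrite (_ : _ \o _ = cst 0).
Qed.

(** The last convolution carries no modulus, but the norm does not see the difference, so layers can
    be peeled off uniformly, the last one included. *)
Lemma csqnorm_cascade_cons f w ws :
  csqnorm (cascade f (w :: ws)) = csqnorm (cascade (cmodulus (convolution f w)) ws).
Proof. by case: ws => [|//]; rewrite /= csqnorm_cmodulus. Qed.

(* Unlike [dilate_cont], normalised in L^1. *)
Definition cdilate psi (t : R) (x : X) : R[i] := (t ^- n)%:C * psi (t^-1 *: x).

Lemma Re_scale (c : R) (z : R[i]) : Re (c%:C * z) = c * Re z.
Proof. by rewrite ReM /= mul0r subr0. Qed.

Lemma Im_scale (c : R) (z : R[i]) : Im (c%:C * z) = c * Im z.
Proof. by rewrite ImM /= mul0r addr0. Qed.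

Lemma Re_cdilate psi t : Re \o cdilate psi t = dilate (Re \o psi) t.
Proof. by apply/funext => x /=; rewrite Re_scale. Qed.

Lemma Im_cdilate psi t : Im \o cdilate psi t = dilate (Im \o psi) t.
Proof. by apply/funext => x /=; rewrite Im_scale. Qed.

Lemma cbounded_L1_cdilate psi t : 0 < t -> cbounded_L1 psi ->
  cbounded_L1 (cdilate psi t).
Proof.
move=> t0 [kr ki]; split; first by rewrite Re_cdilate; exact: bounded_L1_dilate.
by rewrite Im_cdilate; exact: bounded_L1_dilate.
Qed.

(* Uniformity in the base scale [t] is what makes the continuous case follow by
   integration over [t]. *)
Definition square_function_bound psi (K : R) :=
  forall f (t : R) N, cLp 2%:E f -> 0 < t ->
  (\sum_(i < N) csqnorm (convolution f (cdilate psi (t * 2 ^+ i))) <=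
   K%:E * csqnorm f)%E.

Lemma sum_SQ_rconvolution_dilate_le d P Q phi (a : X -> R) (t : R) N :
  0 < d -> cancellative d P Q phi -> square_integrable a -> 0 < t ->
  (\sum_(i < N) SQ (rconvolution a (dilate phi (t * 2 ^+ i))) <=
   (P * Q * (2 / (1 - 2 `^ (- d))) + 1)%:E * SQ a)%E.
Proof.
move=> d0 cphi la t0; have kphi : bounded_L1 phi by case: cphi.
have E b : square_integrable b -> SQ b = (\int[mu]_x (b x ^+ 2))%:E.
  move=> [_ boo]; rewrite /Rintegral fineK// ge0_fin_numE//.
  by apply: integral_ge0 => x _; rewrite lee_fin sqr_ge0.
under eq_bigr => i _.
  rewrite E; last first.
    by apply: square_integrable_rconvolution => //; apply: bounded_L1_dilate => //;
      rewrite mulr_gt0// exprn_gt0.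
  over.
rewrite sumEFin E// -EFinM lee_fin.
exact: sum_rconvolution_dilate_le.
Qed.

Lemma cancellative_square_function_bound psi d1 P1 Q1 d2 P2 Q2 :
  0 < d1 -> 0 < d2 -> cancellative d1 P1 Q1 (Re \o psi) ->
  cancellative d2 P2 Q2 (Im \o psi) ->
  exists2 K, 0 <= K & square_function_bound psi K.
Proof.
move=> d10 d20 c1 c2.
have kpsi : cbounded_L1 psi by split; [case: c1|case: c2].
pose K1 := P1 * Q1 * (2 / (1 - 2 `^ (- d1))) + 1.
pose K2 := P2 * Q2 * (2 / (1 - 2 `^ (- d2))) + 1.
have Kge0 d P Q (phi : X -> R) : 0 < d -> cancellative d P Q phi ->
    0 <= P * Q * (2 / (1 - 2 `^ (- d))) + 1.
  move=> d0 cphi; have P0 := cancellative_ge0 cphi; have Q0 : 0 <= Q by case: cphi.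
  rewrite addr_ge0// !mulr_ge0// invr_ge0 subr_ge0 powRN invf_le1 ?powR_gt0//.
  by rewrite -[leLHS](powRr0 2) ler_powR ?ler1n// ltW.
have K10 : 0 <= K1 by exact: Kge0 c1.
have K20 : 0 <= K2 by exact: Kge0 c2.
(* The real part of [psi] acts on both parts of [f] with constant [K1], the imaginary part with
   [K2]; the 2 comes from [csqnorm_convolution_le]. *)
exists (2 * (K1 + K2)); first by rewrite mulr_ge0// addr_ge0.
move=> f t N lf t0; have [lr li] := cLp2_square_integrable lf.
have [mf _] := lf.
have ti (i : 'I_N) : 0 < t * 2 ^+ i by rewrite mulr_gt0// exprn_gt0.
have F a : square_integrable a -> exists2 r : R, SQ a = r%:E & 0 <= r.
  move=> [ma aoo]; have a0 : (0 <= SQ a)%E by apply: integral_ge0 => x _;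
    rewrite lee_fin sqr_ge0.
  by exists (fine (SQ a)); [rewrite fineK// ge0_fin_numE|exact: fine_ge0].
have [r Er r0] := F _ lr; have [i Ei i0] := F _ li.
have S0 (a : X -> R) : (0 <= SQ a)%E.
  by apply: integral_ge0 => x _; rewrite lee_fin sqr_ge0.
apply: (@le_trans _ _ (\sum_(j < N) (2%:E *
    ((SQ (rconvolution (Re \o f) (dilate (Re \o psi) (t * 2 ^+ j))) +
      SQ (rconvolution (Im \o f) (dilate (Im \o psi) (t * 2 ^+ j)))) +
     (SQ (rconvolution (Re \o f) (dilate (Im \o psi) (t * 2 ^+ j))) +
      SQ (rconvolution (Im \o f) (dilate (Re \o psi) (t * 2 ^+ j)))))))%E).
  apply: lee_sum => j _.
  have := csqnorm_convolution_le lf (cbounded_L1_cdilate (ti j) kpsi).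
  by rewrite Re_cdilate Im_cdilate.
rewrite -ge0_sume_distrr; last by move=> j _; apply: adde_ge0; apply: adde_ge0;
  exact: S0.
have sumE (a b c d : 'I_N -> \bar R) : (\sum_(j < N) ((a j + b j) + (c j + d j)) =
    (\sum_(j < N) a j + \sum_(j < N) b j) + (\sum_(j < N) c j + \sum_(j < N) d j))%E.
  by rewrite !big_split.
rewrite sumE csqnormE// -/(SQ (Re \o f)) -/(SQ (Im \o f)) Er Ei.
have := sum_SQ_rconvolution_dilate_le N d10 c1 lr t0.
have := sum_SQ_rconvolution_dilate_le N d10 c1 li t0.
have := sum_SQ_rconvolution_dilate_le N d20 c2 lr t0.
have := sum_SQ_rconvolution_dilate_le N d20 c2 li t0.
rewrite -/K1 -/K2 Er Ei -!EFinM => H1 H2 H3 H4.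
apply: (@le_trans _ _ (2%:E * ((K1 * r)%:E + (K2 * i)%:E + ((K2 * r)%:E + (K1 * i)%:E)))%E).
  have SS0 (a : 'I_N -> X -> R) : (0 <= \sum_(j < N) SQ (a j))%E.
    by apply: sume_ge0 => j _; exact: S0.
  apply: lee_pmul => //; first by apply: adde_ge0; apply: adde_ge0; exact: SS0.
  by apply: leeD; exact: leeD.
by rewrite -!EFinD -EFinM lee_fin; nra.
Qed.

(** Decay and smoothness pass to the real and imaginary parts because |Re z| and |Im z| are at most
    |z|, and their means are the two components of [cintegral psi]. *)
Lemma wavelet_square_function_bound psi (A eps eps' : R) : (0 < n)%N ->
  wavelet psi -> 0 < A -> 0 < eps -> 0 < eps' ->
  (forall x, normc (psi x) <= A * (1 + enorm x) `^ (- n%:R - eps)) ->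
  (forall y, y != 0 ->
    (\int[mu]_x (normc (psi (x - y) - psi x))%:E <= (A * enorm y `^ eps')%:E)%E) ->
  cbounded_L1 psi /\ exists2 K, 0 <= K & square_function_bound psi K.
Proof.
move=> n0 [[[mr mi] _] _ psi0] A0 eps0 eps'0 psiA psimod.
have mm (phi : X -> R) : measurable_fun setT phi -> forall y, measurable_fun setT
  (fun x : X => (`|phi (x - y) - phi x|)%:E).
  move=> mphi y; apply/measurable_EFinP; apply: measurableT_comp => //.
  by apply: measurable_funB => //; exact: measurable_shift.
have mc y : measurable_fun setT (fun x : X => (normc (psi (x - y) - psi x))%:E).
  apply/measurable_EFinP; apply: measurable_normc.
    rewrite (_ : _ \o _ = fun x => Re (psi (x - y)) - Re (psi x)).
      by apply: measurable_funB => //; exact: (@measurable_shift _ _ _ (Re \o psi)).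
    by apply/funext => x /=; case: (psi _); case: (psi _).
  rewrite (_ : _ \o _ = fun x => Im (psi (x - y)) - Im (psi x)).
    by apply: measurable_funB => //; exact: (@measurable_shift _ _ _ (Im \o psi)).
  by apply/funext => x /=; case: (psi _); case: (psi _).
have [d1 [P1 [Q1 [d10 c1]]]] : exists d P Q, 0 < d /\ cancellative d P Q (Re \o psi).
  apply: (@exists_cancellative _ _ _ A eps eps') => //.
  - by have := f_equal Re psi0.
  - by move=> x; apply: le_trans (psiA x); exact: normrRe_le.
  - move=> y y0; apply: le_trans (psimod y y0); apply: ge0_le_integral => //.
    + exact: mm.
    + move=> x _; rewrite lee_fin /=; apply: le_trans (normrRe_le _).
      by case: (psi _); case: (psi _).
have [d2 [P2 [Q2 [d20 c2]]]] : exists d P Q, 0 < d /\ cancellative d P Q (Im \o psi).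
  apply: (@exists_cancellative _ _ _ A eps eps') => //.
  - by have := f_equal Im psi0.
  - by move=> x; apply: le_trans (psiA x); exact: normrIm_le.
  - move=> y y0; apply: le_trans (psimod y y0); apply: ge0_le_integral => //.
    + exact: mm.
    + move=> x _; rewrite lee_fin /=; apply: le_trans (normrIm_le _).
      by case: (psi _); case: (psi _).
split; first by split; [case: c1|case: c2].
exact: cancellative_square_function_bound c1 c2.
Qed.

End complex_convolution.

(** * Sums and integrals over dyadic scales *)

Section dyadic_scales.
Context {R : realType}.
Local Open Scope ereal_scope.

(** The measure dl / l is invariant under the substitution l = a s. *)
Lemma integral_dyadic_block (G : R -> \bar R) (a : R) : (0 < a)%R ->
  measurable_fun setT G -> (forall x, 0 <= G x) ->
  \int[lebesgue_measure]_(l in `[a, (a * 2)%R[) (G l * (l^-1)%:E) =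
  \int[lebesgue_measure]_(s in `[1%R, 2%R[) (G (a * s)%R * (s^-1)%:E).
Proof.
move=> a0 mG G0; have age0 := ltW a0.
have mGinv : measurable_fun setT (fun l => G l * (l^-1)%:E).
  by apply: emeasurable_funM => //; apply/measurable_EFinP; exact: measurable_inv.
pose D : set R := `[a, (a * 2)%R[%classic.
pose F := (fun l => G l * (l^-1)%:E) \_ D.
have F0 x : 0 <= F x.
  rewrite /F patchE; case: ifPn => // /set_mem; rewrite /D /= in_itv/= => /andP[ax _].
  by rewrite mule_ge0// lee_fin invr_ge0 (le_trans age0 ax).
have mF : measurable_fun setT F by apply/(measurable_restrictT
  (fun l => G l * (l^-1)%:E)); [exact: measurable_itv|apply: measurable_funTS].
rewrite integral_mkcond -/F [RHS]integral_mkcond.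
have H : \int[lebesgue_measure]_x F x = a%:E * \int[lebesgue_measure]_s F (a * s + 0)%R.
  rewrite integral_lebesgue_affine ?gt_eqF// gtr0_norm// muleA -EFinM.
  by rewrite mulfV ?gt_eqF// mul1e.
rewrite H -ge0_integralZl//.
- apply: eq_integral => s _; rewrite addr0 /F !patchE.
  have -> : ((a * s)%R \in D) = (s \in `[1%R, 2%R[%classic).
    apply/idP/idP; rewrite /D !inE/= !in_itv/=.
      by rewrite -[X in (X <= a * s)%R](mulr1 a) ler_pM2l// ltr_pM2l.
    by rewrite -[X in (X <= a * s)%R](mulr1 a) ler_pM2l// ltr_pM2l.
  case: ifPn => [|_]; last by rewrite mule0.
  rewrite muleCA -EFinM invfM mulrA mulfV ?gt_eqF// mul1r//.
- apply: (@measurableT_comp _ _ _ _ _ _ F _ (fun t : R => a * t + 0)%R) => //.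
  by apply: measurable_funD => //; exact: mulrl_measurable.
Qed.

(** Each block from t 2^i to t 2^(i+1) is pulled back to [1, 2), so that a sum over dyadic scales
    with base [t * s] appears under one integral. *)
Lemma integral_dyadic_blocks (G : R -> \bar R) (t : R) N : (0 < t)%R ->
  measurable_fun setT G -> (forall x, 0 <= G x) ->
  \int[lebesgue_measure]_(l in `[t, (t * 2 ^+ N)%R[) (G l * (l^-1)%:E) =
  \int[lebesgue_measure]_(s in `[1%R, 2%R[)
    ((\sum_(i < N) G (t * s * 2 ^+ i)%R) * (s^-1)%:E).
Proof.
move=> t0 mG G0.
have mGc (c : R) : measurable_fun setT (fun s => G (c * s)%R).
  by apply: (measurableT_comp mG); exact: mulrl_measurable.
have mi : measurable_fun setT (fun l : R => (l^-1)%:E).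
  by apply/measurable_EFinP; exact: measurable_inv.
elim: N => [|N IHN].
  rewrite expr0 mulr1 set_itvxx// integral_set0; apply/esym/integral0_eq => s _.
  by rewrite big_ord0 mul0e.
have tN0 : (0 < t * 2 ^+ N)%R by rewrite mulr_gt0// exprn_gt0.
have tN1 : (t <= t * 2 ^+ N)%R by rewrite ler_peMr ?(ltW t0)// exprn_ege1// ler1n.
have tN2 : (t * 2 ^+ N <= t * 2 ^+ N * 2)%R by rewrite ler_peMr ?(ltW tN0)// ler1n.
have inv0 (b x y : R) : (0 < b)%R -> `[b, y[%classic x -> 0 <= (x^-1)%:E.
  by move=> b0; rewrite /= in_itv/= => /andP[bx _];
    rewrite lee_fin invr_ge0 (le_trans (ltW b0) bx).
rewrite exprSr mulrA.
have -> : `[t, (t * 2 ^+ N * 2)%R[%classic =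
    `[t, (t * 2 ^+ N)%R[%classic `|` `[(t * 2 ^+ N)%R, (t * 2 ^+ N * 2)%R[%classic.
  by rewrite -itv_bndbnd_setU// bnd_simp.
rewrite ge0_integral_setU//; last 3 first.
- by apply: measurable_funTS; exact: emeasurable_funM.
- move=> x [] xx; rewrite mule_ge0//; [exact: inv0 xx|exact: inv0 xx].
- apply/disj_setPS => x []/=; rewrite !in_itv/= => /andP[_ +] /andP[+ _].
  by move=> /lt_le_trans /[apply]; rewrite ltxx.
rewrite IHN integral_dyadic_block// -ge0_integralD//; last 4 first.
- by move=> s /(inv0 _ _ _ ltr01) s0; rewrite mule_ge0// sume_ge0.
- apply: measurable_funTS; apply: emeasurable_funM => //; apply: emeasurable_sum => i.
  under eq_fun do rewrite mulrAC.
  exact: mGc.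
- by move=> s /(inv0 _ _ _ ltr01) s0; rewrite mule_ge0.
- by apply: measurable_funTS; apply: emeasurable_funM => //; exact: mGc.
apply: eq_integral => s; rewrite inE => /(inv0 _ _ _ ltr01) s0.
rewrite big_ord_recr/= ge0_muleDl ?sume_ge0//.
by rewrite [X in G X * _](mulrAC t).
Qed.

(** A run of blocks costs at most the integral of B / s over [1, 2), hence at most [B], since 1 / s
    <= 1 on an interval of length 1. Monotone convergence along the intervals from 2^(-N) to 2^N
    exhausts the half-line. *)
Lemma integral_dyadic_le (G : R -> \bar R) (B : \bar R) :
  measurable_fun setT G -> (forall x, 0 <= G x) -> 0 <= B ->
  (forall (t : R) N, (0 < t)%R -> \sum_(i < N) G (t * 2 ^+ i)%R <= B) ->
  \int[lebesgue_measure]_(l in `]0%R, +oo[) (G l * (l^-1)%:E) <= B.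
Proof.
move=> mG G0 B0 GB.
have mi : measurable_fun setT (fun l : R => (l^-1)%:E).
  by apply/measurable_EFinP; exact: measurable_inv.
have mGi D : measurable_fun D (fun l => G l * (l^-1)%:E).
  by apply: measurable_funTS; exact: emeasurable_funM.
pose D N : set R := `[(2 ^- N)%R, (2 ^+ N)%R[%classic.
have blk (t : R) N : (0 < t)%R ->
    \int[lebesgue_measure]_(l in `[t, (t * 2 ^+ N)%R[) (G l * (l^-1)%:E) <= B.
  move=> t0; rewrite integral_dyadic_blocks//.
  apply: (@le_trans _ _ (\int[lebesgue_measure]_(s in `[1%R, 2%R[) cst B s)).
    apply: ge0_le_integral => //.
    - move=> s /=; rewrite in_itv/= => /andP[s1 _].
      by rewrite mule_ge0 ?sume_ge0// lee_fin invr_ge0 (le_trans ler01 s1).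
    - apply: measurable_funTS; apply: emeasurable_funM => //;
      apply: emeasurable_sum => i.
      under eq_fun do rewrite mulrAC.
      by apply: (measurableT_comp mG); exact: mulrl_measurable.
    - move=> s /=; rewrite in_itv/= => /andP[s1 _].
      have s0 : (0 < s)%R by exact: lt_le_trans s1.
      rewrite -[leRHS]mule1; apply: lee_pmul; rewrite ?sume_ge0//.
      + by rewrite lee_fin invr_ge0 ltW.
      + by apply: GB; rewrite mulr_gt0.
      + by rewrite lee_fin invf_le1.
  rewrite integral_cst//= lebesgue_measure_itv/= lte_fin ltr1n/= -EFinB.
  by rewrite (_ : 2 - 1 = 1)%R ?mule1//; ring.
have -> : `]0%R, +oo[%classic = \bigcup_N D N.
  apply/seteqP; split=> [x|x [N _]]; rewrite /D /= !in_itv/= !andbT; last first.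
    by move=> /andP[Nx _]; apply: lt_le_trans Nx; rewrite invr_gt0 exprn_gt0.
  (* Since k < 2^k, Archimedean bounds for x and for 1/x serve as exponents. *)
  move=> x0; pose N := maxn (Num.bound x) (Num.bound x^-1).
  have b2 (y : R) : (0 <= y)%R -> (Num.bound y <= N)%N -> (y < 2 ^+ N)%R.
    move=> y0 yN; apply: lt_le_trans (archi_boundP y0) _.
    by rewrite -natrX ler_nat (leq_trans yN)// ltnW// ltn_expl.
  exists N => //=; rewrite in_itv/= b2 ?leq_maxl ?(ltW x0)// andbT.
  have xV0 : (0 < x^-1)%R by rewrite invr_gt0.
  have := b2 _ (ltW xV0) (leq_maxr _ _) => H.
  by rewrite -[leRHS]invrK lef_pV2 ?posrE ?exprn_gt0// ltW.
have ndD : nondecreasing_seq D.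
  move=> N M NM; apply/subsetPset => x; rewrite /D /= !in_itv/= => /andP[Nx xN].
  apply/andP; split.
    by apply: le_trans Nx; rewrite lef_pV2 ?posrE ?exprn_gt0// ler_eXn2l// ltr1n.
  by apply: lt_le_trans xN _; rewrite ler_eXn2l// ltr1n.
have D0 i x : D i x -> 0 <= G x * (x^-1)%:E.
  rewrite /D /= in_itv/= => /andP[ix _]; rewrite mule_ge0// lee_fin invr_ge0.
  by apply: le_trans ix; rewrite invr_ge0 exprn_ge0.
have H : (fun i => \int[lebesgue_measure]_(l in D i) (G l * (l^-1)%:E)) @ \oo -->
    \int[lebesgue_measure]_(l in \bigcup_i D i) (G l * (l^-1)%:E).
  apply: ge0_nondecreasing_set_cvg_integral; [exact: ndD|by move=> i;
    exact: measurable_itv|by move=> i; exact: mGi|exact: D0].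
rewrite -(cvg_lim _ H)//; apply: lime_le; first by apply/cvg_ex; eexists; exact: H.
(* Starting from 2^(-N), [N + N] dyadic blocks end at 2^N. *)
apply: nearW => N; have := blk (2 ^- N)%R (N + N)%N;
  rewrite exprD mulrA mulVf ?mul1r; last first.
  by rewrite expf_neq0.
by apply; rewrite invr_gt0 exprn_gt0.
Qed.

Lemma ge0_uniq_sub_sum (I : eqType) (s1 s2 : seq I) (a : I -> \bar R) :
  (forall i, 0 <= a i) -> uniq s1 -> uniq s2 -> {subset s1 <= s2} ->
  \sum_(i <- s1) a i <= \sum_(i <- s2) a i.
Proof.
move=> a0 u1 u2 s12; rewrite [leRHS](bigID (mem s1))/=.
have -> : \sum_(i <- s1) a i = \sum_(i <- s2 | i \in s1) a i.
  rewrite -[RHS]big_filter; apply: perm_big; apply: uniq_perm => //.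
    exact: filter_uniq.
  by move=> i; rewrite mem_filter; apply/idP/andP => [i1|[]//]; rewrite s12.
by rewrite leeDl// sume_ge0.
Qed.

(** The sum is a supremum over finite sets, and every finite set of integers lies in a window
    starting at some [- M]. The sum over a window has the shape of a square function with base scale
    2^(-M). *)
Lemma esum_int_le (a : int -> \bar R) (B : \bar R) : (forall j, 0 <= a j) ->
  (forall N M, \sum_(i < N) a (i%:Z - M%:Z)%R <= B) ->
  \esum_(j in [set: int]) a j <= B.
Proof.
move=> a0 aB; apply: ge_ereal_sup => _ /= [X [finX _] <-].
rewrite fsbig_finite//=.
(* The successor makes |j| < M strict, so that j lies in the half-open window from -M to M. *)
pose M := (\max_(j <- finmap.enum_fset (fset_set X)) `|j|%N).+1.
pose s2 : seq int := [seq (i%:Z - M%:Z)%R | i <- iota 0 (M + M)].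
apply: (@le_trans _ _ (\sum_(j <- s2) a j)); last first.
  by rewrite /s2 big_map -{1}(subn0 (M + M)%N) -/(index_iota 0 _) big_mkord.
apply: ge0_uniq_sub_sum => //.
- exact: finmap.fset_uniq.
- rewrite map_inj_uniq ?iota_uniq// => i j /(congr1 (+%R^~ M%:Z)).
  by rewrite !subrK => -[].
move=> j jX; have jM : (absz j < M)%N by rewrite ltnS; exact: leq_bigmax_seq.
apply/mapP; exists (absz (j + M%:Z)%R); last by lia.
by rewrite mem_iota; lia.
Qed.

End dyadic_scales.

(** * Scattering transforms *)

Section cascade_measurability.
Context {R : realType} {n : nat} {d : measure_display} {T : measurableType d}.
Local Notation X := 'rV[R]_n.
Local Notation mu := (@lebesgue_rV R n).
Local Notation Re := (@complex.Re R).
Local Notation Im := (@complex.Im R).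
Implicit Types U W : T * X -> R[i].

(** Joint measurability in the scales and the point: Tonelli needs it to make norms measurable in
    the scales, and it survives convolution in the second variable. *)
Definition cmeasurable_param U :=
  measurable_fun setT (Re \o U) /\ measurable_fun setT (Im \o U).

Lemma cmeasurable_param_convolution U W :
  cmeasurable_param U -> cmeasurable_param W ->
  cmeasurable_param (fun p => convolution (fun y => U (p.1, y))
    (fun y => W (p.1, y)) p.2).
Proof.
move=> [rU iU] [rW iW].
pose p1 (q : (T * X) * X) : T * X := (q.1.1, q.2).
pose p2 (q : (T * X) * X) : T * X := (q.1.1, q.1.2 - q.2).
have m11 : measurable_fun setT (fun q : (T * X) * X => q.1.1).
  exact: (measurableT_comp measurable_fst measurable_fst).
have mp1 : measurable_fun setT p1 by exact: measurable_fun_pair.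
have mp2 : measurable_fun setT p2.
  apply: measurable_fun_pair => //; apply: measurable_rVB => //.
  exact: (measurableT_comp measurable_snd measurable_fst).
have m (a : R[i] -> R) (V : T * X -> R[i]) (p : (T * X) * X -> T * X) :
    measurable_fun setT (a \o V) -> measurable_fun setT p ->
    measurable_fun setT (fun q => a (V (p q))).
  by move=> mV mp; exact: (measurableT_comp mV mp).
split.
  apply: (@measurable_Rintegral_param _ _ _ _ _ mu (fun q : (T * X) * X =>
    Re (U (p1 q) * W (p2 q)))).
  under eq_fun do rewrite ReM.
  by apply: measurable_funB; apply: measurable_funM; exact: m.
apply: (@measurable_Rintegral_param _ _ _ _ _ mu (fun q : (T * X) * X =>
  Im (U (p1 q) * W (p2 q)))).
under eq_fun do rewrite ImM.
by apply: measurable_funD; apply: measurable_funM; exact: m.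
Qed.

(** The initial function [U] may depend on the parameter too: after one layer it does, and the
    induction needs this. *)
Lemma cmeasurable_param_cascade (I : Type) (s : seq I) (W : I -> T * X -> R[i]) U :
  cmeasurable_param U -> (forall i, cmeasurable_param (W i)) ->
  cmeasurable_param (fun p => cascade (fun y => U (p.1, y)) [seq
    (fun y => W i (p.1, y)) | i <- s] p.2).
Proof.
move=> + mW; elim: s U => [|i [|j s] IHs] U mU.
- by rewrite (_ : (fun p => _) = U)//; apply/funext; case.
- exact: cmeasurable_param_convolution.
- have mc := cmeasurable_param_convolution mU (mW i).
  have mV : cmeasurable_param (fun p => cmodulus (convolution (fun y => U (p.1, y))
    (fun y => W i (p.1, y))) p.2).
    split; first by case: mc; exact: measurable_normc.
    by rewrite (_ : _ \o _ = cst 0).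
  exact: IHs mV.
Qed.

Lemma measurable_csqnorm_param U : cmeasurable_param U ->
  measurable_fun setT (fun t => csqnorm (fun y => U (t, y))).
Proof.
move=> [mr mi].
apply: (@measurable_fun_fubini_tonelli_F _ _ _ _ _ mu (fun p => (normc (U p) ^+ 2)%:E)).
  by apply/measurable_EFinP; apply: measurable_funX; exact: measurable_normc.
by move=> p; rewrite lee_fin sqr_ge0.
Qed.

Lemma cLnormE (f : X -> R[i]) : (cLnorm 2%:E f = csqnorm f `^ 2^-1)%E.
Proof.
rewrite -sqr_cLnorm; have := cLnorm_ge0 f; case: (cLnorm 2%:E f) => [r| |]// r0.
  by rewrite -EFin_expe poweR_EFin powR12_sqrt ?sqr_ge0// sqrtr_sqr ger0_norm.
by rewrite expe2 mulyy poweRyr.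
Qed.

End cascade_measurability.

(** * Comparison of the L^2- and L^1-normalised dilations *)

Section dilation_norms.
Context {R : realType} {n : nat}.
Local Notation X := 'rV[R]_n.
Local Notation mu := (@lebesgue_rV R n).
Local Notation Re := (@complex.Re R).
Local Notation Im := (@complex.Im R).
Local Open Scope complex_scope.
Implicit Types f psi : X -> R[i].

Lemma dilate_dyadE psi (j : int) : dilate_dyad psi j = cdilate psi (2 ^ j).
Proof.
apply/funext => x; rewrite /dilate_dyad /cdilate.
rewrite [(2 ^ j) ^+ n]exprnP exprz_exp !invr_expz.
by rewrite [(j * n)%R]mulrC.
Qed.

Lemma dilate_contE psi (l : R) : 0 < l ->
  dilate_cont psi l = fun x => (l `^ (n%:R / 2))%:C * cdilate psi l x.
Proof.
move=> l0; apply/funext => x; rewrite /dilate_cont /cdilate mulrA; congr (_ * _).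
rewrite -rmorphM/=; congr (_%:C); rewrite -powR_invn ?ltW// -powRD.
  by congr (_ `^ _); field.
by rewrite (gt_eqF l0) implybT.
Qed.

Lemma bounded_L1Z (c : R) (phi : X -> R) : bounded_L1 phi -> bounded_L1
  (fun x => c * phi x).
Proof.
move=> [mphi [B phiB] phioo]; split; first exact: measurable_funM.
  by exists (`|c| * B) => x; rewrite normrM ler_wpM2l.
under eq_integral do rewrite normrM EFinM.
rewrite ge0_integralZl//; first exact: lte_mul_pinfty.
by apply/measurable_EFinP; exact: measurableT_comp.
Qed.

Lemma cbounded_L1Z (c : R) (w : X -> R[i]) : cbounded_L1 w -> cbounded_L1
  (fun x => c%:C * w x).
Proof.
move=> [kr ki]; split.
  by rewrite (_ : _ \o _ = fun x => c * Re (w x));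
    [exact: bounded_L1Z|apply/funext => x; exact: Re_scale].
by rewrite (_ : _ \o _ = fun x => c * Im (w x));
  [exact: bounded_L1Z|apply/funext => x; exact: Im_scale].
Qed.

Lemma cbounded_L1_dilate_cont psi (l : R) : 0 < l -> cbounded_L1 psi ->
  cbounded_L1 (dilate_cont psi l).
Proof. by move=> l0 kpsi; rewrite dilate_contE//; apply: cbounded_L1Z;
  exact: cbounded_L1_cdilate. Qed.

Lemma rconvolutionZ (c : R) (a b : X -> R) x : square_integrable a -> bounded_L1 b ->
  rconvolution a (fun y => c * b y) x = c * rconvolution a b x.
Proof.
move=> la kb; rewrite /rconvolution -RintegralZl//; last exact: integrable_rconvolution.
by apply: eq_Rintegral => y _; rewrite mulrCA.
Qed.

Lemma csqnorm_convolutionZ (c : R) f (w : X -> R[i]) : cLp 2%:E f -> cbounded_L1 w ->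
  (csqnorm (convolution f (fun x => c%:C * w x)%R) =
    (c ^+ 2)%:E * csqnorm (convolution f w))%E.
Proof.
move=> lf kw; have [lr li] := cLp2_square_integrable lf; have [kr ki] := kw.
have kcw := cbounded_L1Z c kw.
have rE : Re \o (fun x => c%:C * w x) = fun x => c * (Re \o w) x.
  by apply/funext => x; exact: Re_scale.
have iE : Im \o (fun x => c%:C * w x) = fun x => c * (Im \o w) x.
  by apply/funext => x; exact: Im_scale.
rewrite /csqnorm -ge0_integralZl//.
- apply: eq_integral => x _;
  rewrite -EFinM !normc_sqr !Re_convolution// !Im_convolution//.
  by rewrite rE iE !rconvolutionZ//; congr EFin; ring.
- apply/measurable_EFinP; apply: measurable_funX.
  by have [] := cmeasurable_convolution lf kw; exact: measurable_normc.
- by move=> x _; rewrite lee_fin sqr_ge0.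
- by rewrite lee_fin sqr_ge0.
Qed.

(** The factor [l ^+ n] is what the weight [l ^- n.+1] absorbs, leaving dl / l. *)
Lemma csqnorm_dilate_cont f psi (l : R) : 0 < l -> cLp 2%:E f -> cbounded_L1 psi ->
  (csqnorm (convolution f (dilate_cont psi l)) =
   (l ^+ n)%:E * csqnorm (convolution f (cdilate psi l)))%E.
Proof.
move=> l0 lf kpsi; rewrite dilate_contE// csqnorm_convolutionZ//;
  last exact: cbounded_L1_cdilate.
congr (_%:E * _)%E; rewrite -powR_mulrn ?powR_ge0// -powRrM -powR_mulrn ?ltW//.
by congr (_ `^ _); field.
Qed.

(** The prefactor [k] is left free so that [dilate_cont] and [cdilate] are both instances. *)
Lemma cmeasurable_param_dilation d (T : measurableType d) psi (k s : T -> R) :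
  cmeasurable psi -> measurable_fun setT k -> measurable_fun setT s ->
  cmeasurable_param (fun p : T * X => (k p.1)%:C * psi ((s p.1)^-1 *: p.2)).
Proof.
move=> [mr mi] mk ms.
have ms1 : measurable_fun setT (fun p : T * X => s p.1) by exact: (measurableT_comp ms).
have mk1 : measurable_fun setT (fun p : T * X => k p.1) by exact: (measurableT_comp mk).
have mz : measurable_fun setT (fun p : T * X => (s p.1)^-1 *: p.2).
  apply: measurable_rVZ => //; exact: (measurableT_comp (@measurable_inv R) ms1).
split.
  rewrite (_ : _ \o _ = fun p => k p.1 * (Re \o psi) ((s p.1)^-1 *: p.2)).
    by apply: measurable_funM => //; exact: (measurableT_comp mr).
  by apply/funext => p; exact: Re_scale.
rewrite (_ : _ \o _ = fun p => k p.1 * (Im \o psi) ((s p.1)^-1 *: p.2)).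
  by apply: measurable_funM => //; exact: (measurableT_comp mi).
by apply/funext => p; exact: Im_scale.
Qed.

Lemma cmeasurable_param_dilate_cont d (T : measurableType d) psi (s : T -> R) :
  cmeasurable psi -> measurable_fun setT s ->
  cmeasurable_param (fun p : T * X => dilate_cont psi (s p.1) p.2).
Proof.
move=> mpsi ms; apply: (@cmeasurable_param_dilation _ _ psi
  (fun t => s t `^ (- (n%:R / 2))) s mpsi _ ms).
exact: (measurableT_comp (@measurable_powR R _) ms).
Qed.

Lemma cmeasurable_param_cdilate psi : cmeasurable psi ->
  cmeasurable_param (fun p : R * X => cdilate psi p.1 p.2).
Proof.
move=> mpsi; apply: (@cmeasurable_param_dilation _ _ psi
  (fun t : R => t ^- n) id mpsi) => //.
by apply: (measurableT_comp (@measurable_inv R)); exact: measurable_funX.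
Qed.

Lemma cmeasurable_param_cst d (T : measurableType d) f : cmeasurable f ->
  cmeasurable_param (fun p : T * X => f p.2).
Proof. by move=> [mr mi]; split;
  [exact: (measurableT_comp mr)|exact: (measurableT_comp mi)]. Qed.

End dilation_norms.

(** * Induction over the layers of the scattering transform *)

Section scattering_bounds.
Context {R : realType} {n : nat}.
Local Notation X := 'rV[R]_n.
Local Notation mu := (@lebesgue_rV R n).
Implicit Types f psi : X -> R[i].

Definition weight m (l : 'rV[R]_m) : R := \prod_(i < m) (l ord0 i ^- n.+1).

Lemma measurable_weight m : measurable_fun setT (@weight m).
Proof.
apply: measurable_prod => i _; apply: (measurableT_comp (@measurable_inv R)).
by apply: measurable_funX; exact: measurable_rV_coord.
Qed.

Lemma measurable_orthant m : measurable (@orthant R m).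
Proof.
rewrite (_ : @orthant R m = \bigcap_(i in [set: 'I_m])
    ((fun l : 'rV[R]_m => l ord0 i) @^-1` `]0, +oo[)).
  apply: fin_bigcap_measurable => // i _.
  by rewrite -[X in measurable X]setTI; exact: measurable_rV_coord.
apply/seteqP; split=> l /=.
  by move=> l0 i _ /=; rewrite in_itv/= andbT; exact: l0.
by move=> l0 i; have := l0 i I; rewrite /= in_itv/= andbT.
Qed.

Definition scattering m psi f (l : 'rV[R]_m) : X -> R[i] :=
  cascade f [seq dilate_cont psi (l ord0 i) | i <- enum 'I_m].

Lemma measurable_csqnorm_scattering m psi f : cmeasurable psi -> cmeasurable f ->
  measurable_fun setT (fun l : 'rV[R]_m => csqnorm (scattering psi f l)).
Proof.
move=> mpsi mf.
pose W (i : 'I_m) (p : 'rV[R]_m * X) := dilate_cont psi (p.1 ord0 i) p.2.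
have mW i : cmeasurable_param (W i).
  apply: (@cmeasurable_param_dilate_cont _ _ _ _ psi
    (fun l : 'rV[R]_m => l ord0 i)) => //.
  exact: measurable_rV_coord.
have := cmeasurable_param_cascade (enum 'I_m) (cmeasurable_param_cst 'rV[R]_m mf) mW.
exact: measurable_csqnorm_param.
Qed.

Lemma measurable_S_cont2 m psi f : cmeasurable psi -> cmeasurable f ->
  measurable_fun setT (S_cont2 m psi f).
Proof.
move=> mpsi mf; rewrite (_ : S_cont2 m psi f =
  fun l => csqnorm (scattering psi f l) `^ 2^-1)%E.
  apply: (@measurableT_comp _ _ _ _ _ _ (fun t : \bar R => t `^ 2^-1)%E).
    exact: measurable_poweR.
  exact: measurable_csqnorm_scattering.
by apply/funext => l; rewrite /S_cont2 cLnormE.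
Qed.

(** Coordinate 0 holds the scale of the first convolution, so splitting off a coordinate of the
    scales splits off a layer. *)
Lemma scattering_cons m psi f (t : R) (l : 'rV[R]_m) :
  csqnorm (scattering psi f (rV_cons (t, l))) =
  csqnorm (scattering psi (cmodulus (convolution f (dilate_cont psi t))) l).
Proof.
rewrite /scattering enum_ordSl map_cons csqnorm_cascade_cons rV_cons0 -map_comp.
by congr (csqnorm (cascade _ _)); apply: eq_map => i /=; rewrite rV_consS.
Qed.

Lemma weight_cons m (t : R) (l : 'rV[R]_m) :
  weight (rV_cons (t, l)) = t ^- n.+1 * weight l.
Proof.
by rewrite /weight big_ord_recl rV_cons0; under eq_bigr do rewrite rV_consS.
Qed.

Lemma orthant_cons m (t : R) (l : 'rV[R]_m) :
  (rV_cons (t, l) \in @orthant R m.+1) = (0 < t) && (l \in @orthant R m).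
Proof.
apply/idP/andP; rewrite !inE.
  move=> H; split; first by have := H ord0; rewrite rV_cons0.
  by move=> i; have := H (lift ord0 i); rewrite rV_consS.
move=> [t0 l0] i; have [j ->|->] := unliftP ord0 i.
  by rewrite rV_consS; exact: l0.
by rewrite rV_cons0.
Qed.

Lemma weight_ge0 m (l : 'rV[R]_m) : orthant l -> 0 <= weight l.
Proof. by move=> l0; apply: prodr_ge0 => i _; rewrite invr_ge0 exprn_ge0// ltW. Qed.

Local Open Scope ereal_scope.

(** The first scale t is held fixed while the others are integrated: the induction hypothesis,
    applied to the modulus of the first convolution, gives [K ^+ m]. Integrating the first layer
    over t costs the last factor [K]. The function must therefore vary in the induction. *)
Lemma integral_csqnorm_scattering_le m psi f (K : R) : (0 <= K)%R ->
  cmeasurable psi -> cbounded_L1 psi -> square_function_bound psi K -> cLp 2%:E f ->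
  \int[lebesgue_rV m]_(l in @orthant R m) (csqnorm (scattering psi f l) * (weight l)%:E) <=
  (K ^+ m)%:E * csqnorm f.
Proof.
move=> K0 mpsi kpsi Kpsi.
have mH k g : cmeasurable g -> measurable_fun setT
    (fun l : 'rV[R]_k => csqnorm (scattering psi g l) * (weight l)%:E).
  move=> mg; apply: emeasurable_funM; first exact: measurable_csqnorm_scattering.
  by apply/measurable_EFinP; exact: measurable_weight.
have H0 k g (l : 'rV[R]_k) : orthant l ->
  0 <= csqnorm (scattering psi g l) * (weight l)%:E.
  by move=> l0; rewrite mule_ge0 ?csqnorm_ge0// lee_fin weight_ge0.
elim: m f => [|m IHm] f lf.
  rewrite expr0 mul1e.
  have -> : \int[lebesgue_rV 0]_(l in @orthant R 0) (csqnorm (scattering psi f l) * (weight l)%:E) =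
      \int[lebesgue_rV 0]_(l in @orthant R 0) cst (csqnorm f) l.
    apply: eq_integral => l _; rewrite /weight big_ord0 mule1.
    by rewrite /scattering (size0nil (size_enum_ord 0)).
  (* [lebesgue_rV 0] is a Dirac mass, so the orthant has mass at most 1. *)
  rewrite integral_cst; last exact: measurable_orthant.
  rewrite -[leRHS]mule1; apply: lee_pmul => //; first exact: csqnorm_ge0.
  by rewrite /= diracE; case: (_ \in _).
have mf : cmeasurable f by case: lf.
(* Extension by zero, so that Tonelli can be applied on the whole space; by [orthant_cons] the
   extension vanishes for a nonpositive first scale. *)
pose Phi (l : 'rV[R]_m.+1) :=
  ((fun l => csqnorm (scattering psi f l) * (weight l)%:E) \_ (@orthant R m.+1)) l.
have mPhi : measurable_fun setT Phi.
  apply/(measurable_restrictT (fun l => csqnorm (scattering psi f l) * (weight l)%:E)).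
    exact: measurable_orthant.
  by apply: measurable_funTS; exact: mH.
have Phi0 l : 0 <= Phi l.
  by rewrite /Phi patchE; case: ifPn => // /set_mem; exact: H0.
rewrite integral_mkcond lebesgue_rV_integralS//.
pose G (t : R) := csqnorm (convolution f (cdilate psi t)).
have mG : measurable_fun setT G.
  have := cmeasurable_param_convolution (cmeasurable_param_cst R mf)
    (cmeasurable_param_cdilate mpsi).
  exact: measurable_csqnorm_param.
have mGi : measurable_fun setT (fun t : R => G t * (t^-1)%:E).
  by apply: emeasurable_funM => //; apply/measurable_EFinP; exact: measurable_inv.
have G0 t : 0 <= G t by exact: csqnorm_ge0.
pose H := (fun t => G t * (t^-1)%:E) \_ `]0%R, +oo[.
have mHt : measurable_fun setT H.
  apply/(measurable_restrictT (fun t => G t * (t^-1)%:E)) => //.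
  exact: measurable_funTS.
have Ht0 t : 0 <= H t.
  rewrite /H patchE; case: ifPn => // /set_mem; rewrite /= in_itv/= andbT => t0.
  by rewrite mule_ge0// lee_fin invr_ge0 ltW.
have PhiH (t : R) : \int[lebesgue_rV m]_l Phi (rV_cons (t, l)) <= (K ^+ m)%:E * H t.
  have [t0|t0] := ltP 0%R t; last first.
    rewrite integral0_eq ?mule_ge0 ?lee_fin ?exprn_ge0// => l _.
    by rewrite /Phi patchE orthant_cons ltNge t0.
  have lg : cLp 2%:E (cmodulus (convolution f (dilate_cont psi t))).
    by apply: cLp2_cmodulus; apply: cLp2_convolution => //;
      exact: cbounded_L1_dilate_cont.
  have mg : cmeasurable (cmodulus (convolution f (dilate_cont psi t))) by case: lg.
  have tn0 : (0 <= t ^- n.+1)%R by rewrite invr_ge0 exprn_ge0// ltW.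
  have -> : \int[lebesgue_rV m]_l Phi (rV_cons (t, l)) =
     \int[lebesgue_rV m]_(l in @orthant R m) ((t ^- n.+1)%:E *
       (csqnorm (scattering psi (cmodulus (convolution f (dilate_cont psi t))) l) * (weight l)%:E)).
    rewrite [RHS]integral_mkcond; apply: eq_integral => l _.
    rewrite /Phi !patchE orthant_cons t0/= scattering_cons weight_cons.
    by case: ifP => // _; rewrite EFinM muleCA.
  rewrite ge0_integralZl//; last 3 first.
  - exact: measurable_orthant.
  - by apply: measurable_funTS; exact: mH.
  - by move=> l; exact: H0.
  apply: (@le_trans _ _ ((t ^- n.+1)%:E *
      ((K ^+ m)%:E * csqnorm (convolution f (dilate_cont psi t))))).
    apply: lee_pmul => //.
      by apply: integral_ge0 => l; exact: H0.
    by rewrite -csqnorm_cmodulus; exact: IHm.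
  rewrite csqnorm_dilate_cont// /H patchE mem_set/= ?in_itv/= ?t0//.
  rewrite -/(G t) muleCA; apply: lee_pmul => //.
  - by rewrite lee_fin exprn_ge0.
  - by rewrite !mule_ge0// lee_fin exprn_ge0// ltW.
  (* Here t^n from the normalisation meets t^(-n-1) from the weight, and 1 / t is left. *)
  - rewrite muleA -EFinM muleC exprS invfM -mulrA mulVf ?mulr1//.
    by rewrite expf_neq0// gt_eqF.
apply: (@le_trans _ _ (\int[lebesgue_measure]_t ((K ^+ m)%:E * H t))).
  apply: ge0_le_integral => //.
  - by move=> t _; exact: integral_ge0.
  - apply: (@measurable_fun_fubini_tonelli_F _ _ _ _ _ (lebesgue_rV m) (Phi \o @rV_cons R m)).
      exact: (measurableT_comp mPhi (@measurable_rV_cons R m)).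
    by move=> p; exact: Phi0.
  - exact: emeasurable_funM.
rewrite ge0_integralZl//; last by rewrite lee_fin exprn_ge0.
rewrite exprSr EFinM -muleA; apply: lee_pmul => //.
- by rewrite lee_fin exprn_ge0.
- exact: integral_ge0.
rewrite /H -integral_mkcond; apply: integral_dyadic_le => //.
  by rewrite mule_ge0 ?csqnorm_ge0// lee_fin.
by move=> t N t0; exact: Kpsi.
Qed.

(** * The dyadic counterpart, with integer multi-indices *)

Definition rV_int_cons m (p : int * 'rV[int]_m) : 'rV[int]_m.+1 :=
  (\row_i (if unlift ord0 i is Some k then p.2 ord0 k else p.1))%R.

Lemma rV_int_cons0 m p : @rV_int_cons m p ord0 ord0 = p.1.
Proof. by rewrite mxE unlift_none. Qed.

Lemma rV_int_consS m p (i : 'I_m) : rV_int_cons p ord0 (lift ord0 i) = p.2 ord0 i.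
Proof. by rewrite mxE liftK. Qed.

Lemma rV_int_cons_bij m : set_bij [set: int * 'rV[int]_m] setT (@rV_int_cons m).
Proof.
split=> //.
- move=> [a u] [b v] _ _ e; congr pair.
    by have := rV_int_cons0 (a, u); rewrite e rV_int_cons0.
  by apply/rowP => i; have := rV_int_consS (a, u) i; rewrite e rV_int_consS.
- move=> l _; exists (l ord0 ord0, \row_i l ord0 (lift ord0 i))%R => //.
  apply/rowP => i; have [j ->|->] := unliftP ord0 i.
    by rewrite rV_int_consS mxE.
  by rewrite rV_int_cons0.
Qed.

Definition dyadic_scattering m psi f (j : 'rV[int]_m) : X -> R[i] :=
  cascade f [seq dilate_dyad psi (j ord0 i) | i <- enum 'I_m].

Lemma dyadic_scattering_cons m psi f p :
  csqnorm (@dyadic_scattering m.+1 psi f (rV_int_cons p)) =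
  csqnorm (dyadic_scattering psi (cmodulus (convolution f (dilate_dyad psi p.1))) p.2).
Proof.
rewrite /dyadic_scattering enum_ordSl map_cons csqnorm_cascade_cons rV_int_cons0 -map_comp.
by congr (csqnorm (cascade _ _)); apply: eq_map => i /=; rewrite rV_int_consS.
Qed.

(** The same induction with a sum over the first index in place of the integral; [dilate_dyad] is
    already L^1-normalised, so no weight intervenes. *)
Lemma esum_csqnorm_dyadic_scattering_le m psi f (K : R) : (0 <= K)%R ->
  cbounded_L1 psi -> square_function_bound psi K -> cLp 2%:E f ->
  \esum_(j in [set: 'rV[int]_m]) csqnorm (dyadic_scattering psi f j) <=
  (K ^+ m)%:E * csqnorm f.
Proof.
move=> K0 kpsi Kpsi; elim: m f => [|m IHm] f lf.
  rewrite (_ : setT = [set 0%R]); last first.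
    by apply/seteqP; split=> // x _ /=; apply/rowP; case.
  rewrite esum_set1; last exact: csqnorm_ge0.
  by rewrite /dyadic_scattering (size0nil (size_enum_ord 0)) expr0 mul1e.
rewrite (reindex_esum _ _ _ _ (rV_int_cons_bij m)).
under eq_esum do rewrite dyadic_scattering_cons.
pose a (i : int) (j : 'rV[int]_m) :=
  csqnorm (dyadic_scattering psi (cmodulus (convolution f (dilate_dyad psi i))) j).
rewrite (_ : setT = [set: int] `*`` (fun=> [set: 'rV[int]_m])); last first.
  by apply/seteqP; split.
rewrite -(@esum_esum _ _ _ setT (fun=> setT) a); last by move=> i j _ _;
  exact: csqnorm_ge0.
have p2 (i : int) : (0 < 2 ^ i :> R)%R by rewrite exprz_gt0.
apply: (@le_trans _ _ (\esum_(i in [set: int])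
    ((K ^+ m)%:E * csqnorm (convolution f (cdilate psi (2 ^ i)%R))))).
  apply: le_esum => i _; rewrite -dilate_dyadE -csqnorm_cmodulus.
  apply: IHm; apply: cLp2_cmodulus; apply: cLp2_convolution => //.
  by rewrite dilate_dyadE; exact: cbounded_L1_cdilate.
apply: esum_int_le => [i|N M].
  by rewrite mule_ge0 ?csqnorm_ge0// lee_fin exprn_ge0.
rewrite -ge0_sume_distrr; last by move=> i _; exact: csqnorm_ge0.
rewrite exprSr EFinM -muleA; apply: lee_pmul => //.
- by rewrite lee_fin exprn_ge0.
- by apply: sume_ge0 => i _; exact: csqnorm_ge0.
(* The window starting at [- M] is a run of [N] dyadic scales with base 2^(-M), to which the bound
   uniform in the base scale applies. *)
under eq_bigr do rewrite addrC expfzDr ?pnatr_eq0//.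
exact: Kpsi.
Qed.

End scattering_bounds.

Unset Implicit Arguments.
Set Strict Implicit.

Theorem proposition2 (R : realType) (n m : nat) (psi : 'rV[R]_n -> R[i])
    (A eps eps' : R) :
  (0 < n)%N -> (0 < m)%N ->
  wavelet psi ->
  0 < A -> 0 < eps -> 0 < eps' ->
  (forall x : 'rV[R]_n,
    normc (psi x) <= A * (1 + enorm x) `^ (- n%:R - eps)) ->
  (forall y : 'rV[R]_n, y != 0 ->
    (\int[lebesgue_rV n]_x (normc (psi (x - y) - psi x))%:E
      <= (A * enorm y `^ eps')%:E)%E) ->
  (forall f : 'rV[R]_n -> R[i], cLp 2%:E f -> L2_orthant n (S_cont2 m psi f)) /\
  (forall f : 'rV[R]_n -> R[i], cLp 2%:E f -> l2_int (S_dyad2 m psi f)).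
Proof.
move=> n0 _ wpsi A0 eps0 eps'0 psiA psimod.
have [kpsi [K K0 Kpsi]] :=
  wavelet_square_function_bound n0 wpsi A0 eps0 eps'0 psiA psimod.
have mpsi : cmeasurable psi by case: wpsi => -[].
have finite_bound f : cLp 2%:E f -> ((K ^+ m)%:E * csqnorm f < +oo)%E.
  by move=> /cLp2P[_ foo]; apply: lte_mul_pinfty => //; rewrite lee_fin exprn_ge0.
split=> f lf; last first.
  apply: (@le_lt_trans _ _ ((K ^+ m)%:E * csqnorm f)%E); last exact: finite_bound.
  apply: le_trans (esum_csqnorm_dyadic_scattering_le m K0 kpsi Kpsi lf).
  by apply: le_esum => j _; rewrite gee0_abs ?cLnorm_ge0// sqr_cLnorm.
split.
  by apply: measurable_funTS; apply: measurable_S_cont2 => //; case: lf.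
apply: (@le_lt_trans _ _ ((K ^+ m)%:E * csqnorm f)%E); last exact: finite_bound.
have := integral_csqnorm_scattering_le m K0 mpsi kpsi Kpsi lf.
congr (_ <= _)%E; apply: eq_integral => l _.
by rewrite gee0_abs ?cLnorm_ge0// sqr_cLnorm.
Qed.
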